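(* Let $u\in C(\mathbb R;H^1(\mathbb T;\mathbb R))$ be a solution of $(1-\partial_x^2)u_t+\partial_x(u+u^2/2)=0$ on $\mathbb T\times\mathbb R$, let $C\in\mathbb R$, and set $\beta=1+C$, $z=u-C$, $F_\beta(z)=\beta z+\frac{z^2}{2}$, $\mathcal H_\beta(z)=\frac{\beta z^2}{2}+\frac{z^3}{6}$, and $w=(1-\partial_x^2)^{-1}F_\beta(z)$. For $\alpha\in\mathbb R$ define $$\widetilde N_\alpha(t)=\int_{-\pi}^{\pi}e^{\alpha x}\,\mathcal H_\beta\big(z(x,t)\big)\,dx,\qquad W(x,t)=e^{\alpha x/2}w(x,t)\quad(x\in[-\pi,\pi]).$$ Then $\widetilde N_\alpha\in C^1(\mathbb R)$ and, for every $t\in\mathbb R$, $$\widetilde N_\alpha'(t)=-\frac\alpha2\int_{-\pi}^{\pi}\Big(W_x^2+\Big(\frac{\alpha^2}{4}-1\Big)W^2\Big)dx+\sinh(\alpha\pi)\Big(w_x(\pi,t)^2+\Big(\frac{\alpha^2}{2}-1\Big)w(\pi,t)^2\Big).$$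
   Context: $\mathbb T=\mathbb R/(2\pi\mathbb Z)$; functions on $\mathbb T$ are identified with $2\pi$-periodic functions on $\mathbb R$ and restricted to $[-\pi,\pi]$. $(1-\partial_x^2)^{-1}$ is the Fourier multiplier $(1+k^2)^{-1}$ on $\mathbb T$. A solution $u\in C(\mathbb R;H^1(\mathbb T;\mathbb R))$ is understood in the sense of distributions; equivalently, $u\in C^1(\mathbb R;H^1(\mathbb T))$ with $u_t=-(1-\partial_x^2)^{-1}\partial_x(u+u^2/2)$. One has $w\in C(\mathbb R;H^3(\mathbb T))$, so point values of $w,w_x$ make sense. *)

(* Defs.v *)
From Stdlib Require Export Reals ZArith.
From Coquelicot Require Export Coquelicot.
Open Scope R_scope.

(* A function on T = R/(2 pi Z) is a 2 pi-periodic function R -> R; a function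
   on T x R is f : R -> R -> R with the space variable first, f x t. *)
Definition periodic (f : R -> R) : Prop := forall x, f (x + 2 * PI) = f x.

Definition cexpi (y : R) : C := (cos y, sin y).

(* (1 / 2 pi) int_{-pi}^{pi} f(x) e^{-ikx} dx for real-valued f, split into
   real and imaginary parts. *)
Definition fourier (f : R -> R) (k : Z) : C :=
  (/ (2 * PI) * RInt (fun x => f x * cos (IZR k * x)) (- PI) PI,
   - (/ (2 * PI) * RInt (fun x => f x * sin (IZR k * x)) (- PI) PI)).

Definition zsummable (a : Z -> R) : Prop :=
  ex_series (fun n => a (Z.of_nat n)) /\
  ex_series (fun n => a (- Z.of_nat (S n))%Z).

Definition zsum (a : Z -> R) : R :=
  Series (fun n => a (Z.of_nat n)) + Series (fun n => a (- Z.of_nat (S n))%Z).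

Definition H1_weight (f : R -> R) (k : Z) : R :=
  (1 + IZR k ^ 2) * Cmod (fourier f k) ^ 2.

(* H^1(T; R). Each H^1 class contains exactly one continuous function, which is
   the representative used throughout; Riemann integrals then suffice. *)
Definition in_H1 (f : R -> R) : Prop :=
  periodic f /\ (forall x, continuous f x) /\ zsummable (H1_weight f).

Definition H1_norm (f : R -> R) : R := sqrt (zsum (H1_weight f)).

Definition in_C_H1 (u : R -> R -> R) : Prop :=
  (forall t, in_H1 (fun x => u x t)) /\
  (forall t0, filterlim (fun t => H1_norm (fun x => u x t - u x t0))
                        (locally t0) (locally 0)).

(* Test functions in C_c^oo(T x R) with support in T x [-T, T]. *)
Definition test_function (T : R) (phi : R -> R -> R) : Prop :=
  (forall n x t, ex_diff_n phi n x t) /\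
  (forall t, periodic (fun x => phi x t)) /\
  (forall x t, T <= Rabs t -> phi x t = 0).

(* (1 - d_x^2) u_t + d_x (u + u^2/2) = 0 in D'(T x R), tested against phi and
   with the overall sign changed: partial_derive m k is d_x^m d_t^k. *)
Definition distributional_solution (u : R -> R -> R) : Prop :=
  forall (T : R) (phi : R -> R -> R), 0 < T -> test_function T phi ->
    RInt (fun t =>
      RInt (fun x =>
        u x t * (partial_derive 0 1 phi x t - partial_derive 2 1 phi x t)
        + (u x t + u x t ^ 2 / 2) * partial_derive 1 0 phi x t)
      (- PI) PI) (- T) T = 0.

(* (1 - d_x^2)^{-1} on T, the Fourier multiplier (1 + k^2)^{-1}:
   sum_{k in Z} (1 + k^2)^{-1} fhat(k) e^{ikx}. For real-valued f the terms k
   and -k are conjugate, so the sum is that of the real parts. *)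
Definition inv_one_minus_dxx (f : R -> R) (x : R) : R :=
  zsum (fun k =>
    Re (RtoC (/ (1 + IZR k ^ 2)) * fourier f k * cexpi (IZR k * x))%C).

Definition F (beta z : R) : R := beta * z + z ^ 2 / 2.

Definition calH (beta z : R) : R := beta * z ^ 2 / 2 + z ^ 3 / 6.

Definition is_C1 (f : R -> R) : Prop :=
  forall t, ex_derive f t /\ continuous (Derive f) t.

(* Main.v *)
Require Import Defs.
From Stdlib Require Import Reals ZArith Lra Lia FunctionalExtensionality.
From Coquelicot Require Import Coquelicot.
Open Scope R_scope.

(** Testing the equation against [cos (k x) chi(t)] and [sin (k x) chi(t)] shows that each
    Fourier coefficient of [u] is differentiable in time, with the derivative of the
    corresponding coefficient of [- w_x]. Since a continuous function is determined by its
    Fourier coefficients (Fejer), [u_t = - w_x] holds pointwise. As [calH' = F] and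
    [F(z) = w - w_xx], this gives [N' = - int e^(alpha x) (w - w_xx) w_x], and the claimed
    formula follows by integrating the exact derivative of
    [e^(alpha x) ((w_x^2 - w^2) / 2 + alpha^2 w^2 / 4)].

    The multiplier [(1 + k^2)^(-1)] is realised by an explicit Green function, again by
    comparing Fourier coefficients. Joint continuity of [u] comes from the Sobolev bound
    of the sup norm by the H^1 norm, itself a consequence of Fejer's theorem. *)

(** Differentiability in time of every Fourier coefficient says nothing yet about [u] at a point,
    and differentiating the series term by term would call for a convergence that is not at hand. So
    the equation is used in integrated form: [u(t) - u(0) + int_0^t w_x] is continuous in [x], its
    coefficients are constant in time and vanish at [t = 0], hence it is zero; only then is it
    differentiated in [t]. This requires [w_x] to be jointly continuous, whence the sup norm bound
    on the derivative of the Green operator. Uniqueness and the Sobolev bound both go through Cesaro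
    means, so neither has to prove that a Fourier series converges. The shift by [C] is harmless:
    [F_beta(z)] differs from [u + u^2/2] by the constant [C + C^2/2], which integrates to zero
    against the derivative of a periodic test function. In the final identity [w_xx] is replaced by
    [w - F_beta(z)], so no derivative of [F_beta(z)] appears. *)

(** * Continuous functions and their integrals *)

(* [RInt] lives in a carrier that [ring] and [lra] do not recognise as [R]. *)
Ltac eqR := match goal with |- @eq _ ?a ?b => change (@eq R a b) end.

Definition cts (f : R -> R) : Prop := forall x, continuous f x.

Lemma cts_const (a : R) : cts (fun _ => a).
Proof. intros x; apply continuous_const. Qed.

Lemma cts_id : cts (fun x => x).
Proof. intros x; apply continuous_id. Qed.

Lemma cts_plus (f g : R -> R) : cts f -> cts g -> cts (fun x => f x + g x).
Proof. intros Hf Hg x; exact (continuous_plus f g x (Hf x) (Hg x)). Qed.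

Lemma cts_opp (f : R -> R) : cts f -> cts (fun x => - f x).
Proof. intros Hf x; exact (continuous_opp f x (Hf x)). Qed.

Lemma cts_minus (f g : R -> R) : cts f -> cts g -> cts (fun x => f x - g x).
Proof. intros Hf Hg x; exact (continuous_minus f g x (Hf x) (Hg x)). Qed.

Lemma cts_mult (f g : R -> R) : cts f -> cts g -> cts (fun x => f x * g x).
Proof. intros Hf Hg x; exact (continuous_mult f g x (Hf x) (Hg x)). Qed.

Lemma cts_div_const (f : R -> R) (a : R) : cts f -> cts (fun x => f x / a).
Proof. intros Hf; apply cts_mult; [exact Hf | apply cts_const]. Qed.

Lemma cts_pow (f : R -> R) (n : nat) : cts f -> cts (fun x => f x ^ n).
Proof.
  intros Hf; induction n as [|n IH]; simpl; [apply cts_const|].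
  now apply cts_mult.
Qed.

Lemma cts_comp (f g : R -> R) : cts f -> cts g -> cts (fun x => g (f x)).
Proof. intros Hf Hg x; exact (continuous_comp f g x (Hf x) (Hg (f x))). Qed.

Lemma cts_cos (f : R -> R) : cts f -> cts (fun x => cos (f x)).
Proof. intros Hf; apply (cts_comp f cos Hf); intros x; apply continuous_cos. Qed.

Lemma cts_sin (f : R -> R) : cts f -> cts (fun x => sin (f x)).
Proof. intros Hf; apply (cts_comp f sin Hf); intros x; apply continuous_sin. Qed.

Lemma cts_exp (f : R -> R) : cts f -> cts (fun x => exp (f x)).
Proof. intros Hf; apply (cts_comp f exp Hf); intros x; apply continuous_exp. Qed.

Lemma cts_abs (f : R -> R) : cts f -> cts (fun x => Rabs (f x)).
Proof. intros Hf; apply (cts_comp f Rabs Hf); intros x; apply continuous_Rabs. Qed.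

Lemma cts_ext (f g : R -> R) : (forall x, f x = g x) -> cts f -> cts g.
Proof. intros E Hf x; apply continuous_ext with f; auto. Qed.

Lemma cts_deriv (f df : R -> R) : (forall x, is_derive f x (df x)) -> cts f.
Proof. intros H x; apply (ex_derive_continuous (V := R_NormedModule) f); exists (df x); apply H. Qed.

Lemma cts_continuity_pt (f : R -> R) : cts f -> forall x, continuity_pt f x.
Proof. intros H x; apply continuity_pt_filterlim, H. Qed.

Lemma is_derive_Rmult (f g : R -> R) (x df dg : R) :
  is_derive f x df -> is_derive g x dg ->
  is_derive (fun x => f x * g x) x (df * g x + f x * dg).
Proof. intros Hf Hg; exact (is_derive_mult f g x df dg Hf Hg Rmult_comm). Qed.

Lemma is_derive_Rplus (f g : R -> R) (x df dg : R) :
  is_derive f x df -> is_derive g x dg -> is_derive (fun x => f x + g x) x (df + dg).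
Proof. exact (is_derive_plus (V := R_NormedModule) f g x df dg). Qed.

Lemma is_derive_Rminus (f g : R -> R) (x df dg : R) :
  is_derive f x df -> is_derive g x dg -> is_derive (fun x => f x - g x) x (df - dg).
Proof. exact (is_derive_minus (V := R_NormedModule) f g x df dg). Qed.

Lemma is_derive_Ropp (f : R -> R) (x df : R) :
  is_derive f x df -> is_derive (fun x => - f x) x (- df).
Proof. exact (is_derive_opp (V := R_NormedModule) f x df). Qed.

Lemma is_derive_Rdiv_const (f : R -> R) (a x df : R) :
  is_derive f x df -> is_derive (fun x => f x / a) x (df / a).
Proof. exact (is_derive_scal_l (V := R_NormedModule) f x df (/ a)). Qed.

Lemma is_derive_Rmult_const (f : R -> R) (a x df : R) :
  is_derive f x df -> is_derive (fun y => f y * a) x (df * a).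
Proof. exact (is_derive_scal_l (V := R_NormedModule) f x df a). Qed.

Lemma is_derive_Rconst_mult (f : R -> R) (a x df : R) :
  is_derive f x df -> is_derive (fun y => a * f y) x (a * df).
Proof. exact (is_derive_scal f x a df). Qed.

(** Separates the differentiation rules, which fix [a] by unification, from the algebra that brings
    the result into the wanted form. *)
Lemma is_derive_eq (f : R -> R) (x a b : R) : is_derive f x a -> a = b -> is_derive f x b.
Proof. now intros H <-. Qed.

Create HintDb cts.
#[local] Hint Resolve cts_const cts_id cts_plus cts_opp cts_minus cts_mult
  cts_div_const cts_pow cts_cos cts_sin cts_exp cts_abs : cts.

Lemma cts_ex_RInt (f : R -> R) (a b : R) : cts f -> ex_RInt f a b.
Proof. intros H; apply (ex_RInt_continuous (V := R_CompleteNormedModule)); intros; apply H. Qed.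

Lemma cRInt_plus (f g : R -> R) (a b : R) : cts f -> cts g ->
  RInt (fun x => f x + g x) a b = RInt f a b + RInt g a b.
Proof.
  intros Hf Hg; exact (RInt_plus (V := R_CompleteNormedModule) f g a b (cts_ex_RInt f a b Hf) (cts_ex_RInt g a b Hg)).
Qed.

Lemma cRInt_minus (f g : R -> R) (a b : R) : cts f -> cts g ->
  RInt (fun x => f x - g x) a b = RInt f a b - RInt g a b.
Proof.
  intros Hf Hg; exact (RInt_minus (V := R_CompleteNormedModule) f g a b (cts_ex_RInt f a b Hf) (cts_ex_RInt g a b Hg)).
Qed.

Lemma cRInt_scal (f : R -> R) (l a b : R) : cts f ->
  RInt (fun x => l * f x) a b = l * RInt f a b.
Proof.
  intros Hf; exact (RInt_scal (V := R_CompleteNormedModule) f a b l (cts_ex_RInt f a b Hf)).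
Qed.

Lemma RInt_eq (f g : R -> R) (a b : R) : (forall x, f x = g x) ->
  RInt f a b = RInt g a b.
Proof. intros H; apply (RInt_ext (V := R_CompleteNormedModule)); auto. Qed.

Lemma RInt_antideriv (f df : R -> R) (a b : R) :
  (forall x, is_derive f x (df x)) -> cts df -> RInt df a b = f b - f a.
Proof.
  intros H C; apply is_RInt_unique.
  exact (is_RInt_derive (V := R_CompleteNormedModule) f df a b (fun x _ => H x) (fun x _ => C x)).
Qed.

Lemma abs_RInt_le_fun (f g : R -> R) (a b : R) : a <= b -> cts f -> cts g ->
  (forall x, Rabs (f x) <= g x) -> Rabs (RInt f a b) <= RInt g a b.
Proof.
  intros Hab Hf Hg H.
  eapply Rle_trans.
  - apply abs_RInt_le; [exact Hab | now apply cts_ex_RInt].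
  - apply RInt_le; auto; apply cts_ex_RInt; auto 12 with cts.
Qed.

Lemma RInt_cst (a b v : R) : RInt (fun _ => v) a b = (b - a) * v.
Proof. exact (RInt_const (V := R_CompleteNormedModule) a b v). Qed.

(** * Periodic functions *)

Lemma periodic_shift_nat (f : R -> R) (n : nat) (x : R) :
  periodic f -> f (x + INR n * (2 * PI)) = f x.
Proof.
  intros Hf; induction n as [|n IH].
  - f_equal; simpl; ring.
  - rewrite <- IH, <- (Hf (x + INR n * (2 * PI))), S_INR; f_equal; ring.
Qed.

Lemma periodic_shift (f : R -> R) (m : Z) (x : R) :
  periodic f -> f (x + IZR m * (2 * PI)) = f x.
Proof.
  intros Hf; destruct (Z_le_gt_dec 0 m) as [Hm|Hm].
  - rewrite <- (Z2Nat.id m Hm), <- INR_IZR_INZ; now apply periodic_shift_nat.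
  - rewrite <- (periodic_shift_nat f (Z.to_nat (- m)) (x + _) Hf).
    f_equal; rewrite INR_IZR_INZ, Z2Nat.id, opp_IZR by lia; ring.
Qed.

Lemma periodic_sin : periodic sin.
Proof. intros x; rewrite sin_plus, cos_2PI, sin_2PI; ring. Qed.

Lemma periodic_cos : periodic cos.
Proof. intros x; rewrite cos_plus, cos_2PI, sin_2PI; ring. Qed.

Lemma periodic_reflect (h : R -> R) (k : nat) (x : R) : periodic h ->
  periodic (fun y => h (INR k * (x - y))).
Proof.
  intros Ph y; rewrite <- (periodic_shift h (Z.of_nat k) _ Ph), <- INR_IZR_INZ.
  f_equal; ring.
Qed.

Lemma periodic_dilate (h : R -> R) (k : nat) : periodic h -> periodic (fun y => h (INR k * y)).
Proof.
  intros Ph y; rewrite <- (periodic_shift h (Z.of_nat k) (INR k * y) Ph), <- INR_IZR_INZ.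
  f_equal; ring.
Qed.

Lemma reduce_mod_2PI (x y : R) :
  exists m : Z, - PI <= y + IZR m * (2 * PI) - x <= PI.
Proof.
  assert (Hpi := PI_RGT_0).
  (* [up r] lies in [(r, r + 1]], so this choice of [r] puts the shifted difference in
     [(- PI, PI]]. *)
  destruct (archimed ((x - y - PI) / (2 * PI))) as [H1 H2].
  set (m := up ((x - y - PI) / (2 * PI))) in *.
  assert (E : (x - y - PI) = ((x - y - PI) / (2 * PI)) * (2 * PI)) by (field; lra).
  set (q := (x - y - PI) / (2 * PI)) in *.
  exists m.
  assert (q * (2 * PI) < IZR m * (2 * PI)) by (apply Rmult_lt_compat_r; lra).
  assert (IZR m * (2 * PI) <= (q + 1) * (2 * PI)) by (apply Rmult_le_compat_r; lra).
  lra.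
Qed.

Lemma periodic_bounded (f : R -> R) : periodic f -> cts f ->
  exists M, 0 <= M /\ forall x, Rabs (f x) <= M.
Proof.
  intros Pf Cf.
  assert (Hpi := PI_RGT_0).
  destruct (continuity_ab_maj (fun x => Rabs (f x)) (- PI) PI) as [m [Hm _]].
  - lra.
  - intros c _; apply cts_continuity_pt; auto 12 with cts.
  - exists (Rabs (f m)); split; [apply Rabs_pos|]; intros x.
    destruct (reduce_mod_2PI 0 x) as [k Hk].
    rewrite <- (periodic_shift f k x Pf); apply Hm; lra.
Qed.

(** * Fejer's theorem *)

Fixpoint dirichlet (n : nat) (th : R) : R :=
  match n with
  | O => 1
  | S m => dirichlet m th + 2 * cos (INR (S m) * th)
  end.

Lemma dirichlet_S (n : nat) (th : R) :
  dirichlet (S n) th = dirichlet n th + 2 * cos (INR (S n) * th).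
Proof. reflexivity. Qed.

(** Unnormalised: [n + 1] times the usual Fejer kernel. The factor is divided out only when the
    Cesaro mean is formed. *)
Definition fejer (n : nat) (th : R) : R := sum_f_R0 (fun j => dirichlet j th) n.

(** The closed form of the kernel is kept multiplied by [1 - cos th], which avoids a division that
    fails at multiples of [2 PI]; the right side is then ready to be summed again. *)
Lemma dirichlet_telescope (n : nat) (th : R) :
  dirichlet n th * (1 - cos th) = cos (INR n * th) - cos (INR (S n) * th).
Proof.
  induction n as [|n IH].
  - simpl; rewrite Rmult_0_l, cos_0, !Rmult_1_l; ring.
  - rewrite dirichlet_S, Rmult_plus_distr_r, IH.
    replace (INR n * th) with (INR (S n) * th - th) by (rewrite S_INR; ring).
    replace (INR (S (S n)) * th) with (INR (S n) * th + th)
      by (rewrite (S_INR (S n)); ring).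
    rewrite cos_plus, cos_minus; ring.
Qed.

Lemma fejer_telescope (n : nat) (th : R) :
  fejer n th * (1 - cos th) = 1 - cos (INR (S n) * th).
Proof.
  unfold fejer; induction n as [|n IH].
  - simpl; rewrite !Rmult_1_l; ring.
  - rewrite tech5, Rmult_plus_distr_r, IH.
    rewrite dirichlet_telescope; ring.
Qed.

(** Covers the points where the factor [1 - cos th] vanishes and the telescoped identity says
    nothing about the sign of the kernel. *)
Lemma dirichlet_cos_1 (n : nat) (th : R) : cos th = 1 -> 1 <= dirichlet n th.
Proof.
  intros Hc.
  assert (Hs : sin th = 0).
  { generalize (sin2_cos2 th); rewrite Hc; unfold Rsqr; intros H.
    assert (sin th * sin th = 0) by lra.
    now destruct (Rmult_integral _ _ H0). }
  assert (H : forall k, cos (INR k * th) = 1).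
  { induction k as [|k IH]; [simpl; rewrite Rmult_0_l; apply cos_0|].
    rewrite S_INR, Rmult_plus_distr_r, Rmult_1_l, cos_plus, IH, Hc, Hs; ring. }
  induction n as [|n IH]; [apply Rle_refl|]; rewrite dirichlet_S, H; lra.
Qed.

Lemma fejer_nonneg (n : nat) (th : R) : 0 <= fejer n th.
Proof.
  destruct (Req_dec (cos th) 1) as [E|E].
  - apply cond_pos_sum; intros k.
    generalize (dirichlet_cos_1 k th E); lra.
  - generalize (COS_bound th) (COS_bound (INR (S n) * th)) (fejer_telescope n th).
    intros B1 B2 T.
    apply Rmult_le_reg_r with (1 - cos th); lra.
Qed.

Lemma cts_dirichlet (n : nat) (f : R -> R) : cts f -> cts (fun y => dirichlet n (f y)).
Proof. intros Hf; induction n; simpl dirichlet; auto 12 with cts. Qed.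

Lemma cts_fejer (n : nat) (f : R -> R) : cts f -> cts (fun y => fejer n (f y)).
Proof.
  intros Hf; unfold fejer; induction n; simpl sum_f_R0.
  - auto 12 with cts.
  - apply cts_plus; [exact IHn | apply (cts_dirichlet (S n) f Hf)].
Qed.
#[local] Hint Resolve cts_dirichlet cts_fejer : cts.

Lemma RInt_cos_shift (n : nat) (x : R) :
  RInt (fun y => cos (INR (S n) * (x - y))) (- PI) PI = 0.
Proof.
  assert (Hn : INR (S n) <> 0) by (apply not_0_INR; lia).
  rewrite (RInt_antideriv (fun y => - sin (INR (S n) * (x - y)) / INR (S n))); cbv beta.
  - assert (E := periodic_reflect sin (S n) x periodic_sin (- PI)); cbv beta in E.
    replace (- PI + 2 * PI) with PI in E by ring.
    rewrite E; eqR; ring.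
  - intros y; generalize (INR (S n)) Hn; intros k Hk.
    auto_derive; [trivial|]; unfold Rminus; field; exact Hk.
  - auto 12 with cts.
Qed.

Lemma RInt_dirichlet (n : nat) (x : R) :
  RInt (fun y => dirichlet n (x - y)) (- PI) PI = 2 * PI.
Proof.
  induction n as [|n IH].
  - simpl; rewrite RInt_cst; eqR; ring.
  - rewrite (RInt_eq _ (fun y => dirichlet n (x - y) + 2 * cos (INR (S n) * (x - y))))
      by reflexivity.
    rewrite cRInt_plus, cRInt_scal, IH, RInt_cos_shift; auto 12 with cts; eqR; ring.
Qed.

Lemma RInt_fejer (n : nat) (x : R) :
  RInt (fun y => fejer n (x - y)) (- PI) PI = INR (S n) * (2 * PI).
Proof.
  induction n as [|n IH].
  - unfold fejer; simpl; rewrite RInt_cst; eqR; ring.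
  - rewrite (RInt_eq _ (fun y => fejer n (x - y) + dirichlet (S n) (x - y)))
      by (intros y; apply tech5).
    rewrite (cRInt_plus (fun y => fejer n (x - y))
      (fun y => dirichlet (S n) (x - y))), IH, (RInt_dirichlet (S n)), (S_INR (S n)).
    + eqR; ring.
    + auto 12 with cts.
    + auto 12 with cts.
Qed.

(** The real part of [fhat(k) e^(ikx)]. Frequencies [k] and [-k] together contribute twice this
    value, except that frequency 0 is counted once. *)
Definition fourier_mode (f : R -> R) (k : nat) (x : R) : R :=
  / (2 * PI) * RInt (fun y => f y * cos (INR k * (x - y))) (- PI) PI.

Definition fourier_psum (f : R -> R) (n : nat) (x : R) : R :=
  / (2 * PI) * RInt (fun y => f y * dirichlet n (x - y)) (- PI) PI.

Lemma fourier_psum_eq (f : R -> R) (n : nat) (x : R) : cts f ->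
  fourier_psum f n x = 2 * sum_f_R0 (fun k => fourier_mode f k x) n - fourier_mode f 0 x.
Proof.
  intros Hf; induction n as [|n IH].
  - unfold fourier_psum, fourier_mode; simpl.
    rewrite (RInt_eq (fun y => f y * cos (0 * (x - y))) (fun y => f y * 1)).
    + ring.
    + intros y; rewrite Rmult_0_l, cos_0; ring.
  - rewrite tech5.
    replace (fourier_psum f (S n) x) with
      (fourier_psum f n x + 2 * fourier_mode f (S n) x); [rewrite IH; ring|].
    unfold fourier_psum, fourier_mode.
    rewrite (RInt_eq (fun y => f y * dirichlet (S n) (x - y))
      (fun y => f y * dirichlet n (x - y) + 2 * (f y * cos (INR (S n) * (x - y))))).
    + rewrite cRInt_plus, cRInt_scal; auto 12 with cts; eqR; ring.
    + intros y; rewrite dirichlet_S; ring.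
Qed.

Lemma fourier_fejer_eq (f : R -> R) (n : nat) (x : R) : cts f ->
  sum_f_R0 (fun j => fourier_psum f j x) n =
  / (2 * PI) * RInt (fun y => f y * fejer n (x - y)) (- PI) PI.
Proof.
  intros Hf; induction n as [|n IH].
  - reflexivity.
  - rewrite tech5, IH; unfold fourier_psum.
    rewrite (RInt_eq (fun y => f y * fejer (S n) (x - y))
      (fun y => f y * fejer n (x - y) + f y * dirichlet (S n) (x - y))).
    + rewrite cRInt_plus; auto 12 with cts; eqR; ring.
    + intros y; unfold fejer; rewrite tech5; ring.
Qed.

(* Korovkin's trick: away from [x] the oscillation of [f] is absorbed by
   [1 - cos (x - y)], against which the Fejer kernel integrates to O(1). *)
Lemma oscillation_bound (f : R -> R) (x eps : R) : periodic f -> cts f -> 0 < eps ->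
  exists C, 0 <= C /\ forall y, Rabs (f y - f x) <= eps + C * (1 - cos (x - y)).
Proof.
  intros Pf Cf He.
  destruct (periodic_bounded f Pf Cf) as [M [HM B]].
  destruct (proj1 (filterlim_locally f (f x)) (Cf x) (mkposreal eps He)) as [d Hd].
  (* Keeps the radius inside [(0, PI)], where [cos] decreases, so that [1 - cos d'] is positive. *)
  set (d' := Rmin d (PI / 2)).
  assert (Hpi := PI_RGT_0).
  assert (Hd' : 0 < d' <= PI / 2).
  { split; [apply Rmin_pos; [apply cond_pos | lra] | apply Rmin_r]. }
  assert (Hc : cos d' < 1).
  { rewrite <- cos_0; apply cos_decreasing_1; lra. }
  (* At distance at least [d'] the oscillation is at most [2 * M], while [1 - cos] is at least
     [1 - cos d']. *)
  exists (2 * M / (1 - cos d')).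
  assert (HC : 0 <= 2 * M / (1 - cos d')).
  { apply Rmult_le_pos; [lra|]; apply Rlt_le, Rinv_0_lt_compat; lra. }
  split; [exact HC|]; intros y.
  destruct (reduce_mod_2PI x y) as [m Hm].
  rewrite <- (periodic_shift f m y Pf).
  replace (cos (x - y)) with (cos (y + IZR m * (2 * PI) - x)).
  2: { rewrite <- (cos_neg (x - y)), <- (periodic_shift cos m (- (x - y))).
       - f_equal; ring.
       - apply periodic_cos. }
  set (y' := y + IZR m * (2 * PI)) in *.
  assert (HA : 0 <= Rabs (y' - x)) by apply Rabs_pos.
  assert (Hcos : cos (y' - x) = cos (Rabs (y' - x))).
  { unfold Rabs; destruct (Rcase_abs (y' - x)); [now rewrite cos_neg | reflexivity]. }
  destruct (Rlt_le_dec (Rabs (y' - x)) d') as [H|H].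
  - assert (Rabs (f y' - f x) < eps).
    { apply (Hd y'); eapply Rlt_le_trans; [exact H | apply Rmin_l]. }
    assert (0 <= 2 * M / (1 - cos d') * (1 - cos (y' - x))).
    { apply Rmult_le_pos; [exact HC|]; generalize (COS_bound (y' - x)); lra. }
    lra.
  - assert (Rabs (y' - x) <= PI) by (apply Rabs_le; lra).
    assert (cos (y' - x) <= cos d').
    { rewrite Hcos; apply cos_decr_1; lra. }
    assert (Rabs (f y' - f x) <= 2 * M).
    { eapply Rle_trans; [apply Rabs_triang|]; rewrite Rabs_Ropp.
      generalize (B y') (B x); lra. }
    assert (2 * M <= 2 * M / (1 - cos d') * (1 - cos (y' - x))).
    { apply Rle_trans with (2 * M / (1 - cos d') * (1 - cos d')).
      - right; field; lra.
      - apply Rmult_le_compat_l; lra. }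
    lra.
Qed.

Lemma fejer_cv (f : R -> R) (x : R) : periodic f -> cts f ->
  Un_cv (fun n => sum_f_R0 (fun j => fourier_psum f j x) n / INR (S n)) (f x).
Proof.
  intros Pf Cf eps He.
  assert (Hpi := PI_RGT_0).
  destruct (oscillation_bound f x (eps / 2) Pf Cf) as [C [HC B]]; [lra|].
  (* From this rank on the error term [2 * C / INR (S n)] is below [eps / 2]. *)
  destruct (INR_unbounded (4 * C / eps)) as [N HN].
  exists N; intros n Hn; unfold R_dist.
  assert (HNn : 4 * C / eps < INR (S n)).
  { eapply Rlt_le_trans; [exact HN | apply le_INR; lia]. }
  assert (Hn0 : 0 < INR (S n)) by (apply lt_0_INR; lia).
  rewrite fourier_fejer_eq by exact Cf.
  replace (/ (2 * PI) * RInt (fun y => f y * fejer n (x - y)) (- PI) PI / INR (S n) - f x)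
    with (/ (2 * PI * INR (S n)) *
      RInt (fun y => (f y - f x) * fejer n (x - y)) (- PI) PI).
  2: { rewrite (RInt_eq (fun y => (f y - f x) * fejer n (x - y))
         (fun y => f y * fejer n (x - y) - f x * fejer n (x - y))) by (intros; ring).
       rewrite cRInt_minus, cRInt_scal, RInt_fejer; auto 12 with cts.
       field; split; lra. }
  rewrite Rabs_mult, Rabs_pos_eq by (apply Rlt_le, Rinv_0_lt_compat; nra).
  assert (HI : Rabs (RInt (fun y => (f y - f x) * fejer n (x - y)) (- PI) PI)
    <= eps / 2 * (INR (S n) * (2 * PI)) + C * (2 * PI * 2)).
  { eapply Rle_trans.
    - apply abs_RInt_le_fun with
        (g := fun y => eps / 2 * fejer n (x - y) + C * (1 - cos (INR (S n) * (x - y))));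
        auto 12 with cts; [lra|].
      intros y; rewrite Rabs_mult, (Rabs_pos_eq _ (fejer_nonneg n (x - y))).
      rewrite <- fejer_telescope.
      generalize (B y) (fejer_nonneg n (x - y)); nra.
    - rewrite cRInt_plus, !cRInt_scal, RInt_fejer; auto 12 with cts.
      apply Rplus_le_compat_l, Rmult_le_compat_l; [exact HC|].
      rewrite cRInt_minus, RInt_cst, RInt_cos_shift; auto 12 with cts; lra. }
  apply Rle_lt_trans with (/ (2 * PI * INR (S n)) *
    (eps / 2 * (INR (S n) * (2 * PI)) + C * (2 * PI * 2))).
  { apply Rmult_le_compat_l; [apply Rlt_le, Rinv_0_lt_compat; nra | exact HI]. }
  replace (/ (2 * PI * INR (S n)) *
    (eps / 2 * (INR (S n) * (2 * PI)) + C * (2 * PI * 2)))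
    with (eps / 2 + 2 * C / INR (S n)) by (field; split; lra).
  assert (2 * C / INR (S n) < eps / 2).
  { apply Rmult_lt_reg_r with (INR (S n)); [exact Hn0|].
    replace (2 * C / INR (S n) * INR (S n)) with (4 * C / eps * (eps / 2)) by (field; lra).
    rewrite (Rmult_comm (eps / 2)).
    apply Rmult_lt_compat_r; lra. }
  lra.
Qed.

(** A uniform bound on the partial sums is inherited by their means, which do converge to [f x]; the
    partial sums themselves may diverge. *)
Lemma fejer_bound (f : R -> R) (x S : R) : periodic f -> cts f ->
  (forall n, Rabs (fourier_psum f n x) <= S) -> Rabs (f x) <= S.
Proof.
  intros Pf Cf H.
  assert (HS : forall n, Rabs (sum_f_R0 (fun j => fourier_psum f j x) n) <= S * INR (Datatypes.S n)).
  { induction n as [|n IH].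
    - simpl sum_f_R0; rewrite Rmult_1_r; apply H.
    - rewrite tech5, (S_INR (Datatypes.S n)); eapply Rle_trans; [apply Rabs_triang|].
      generalize (H (Datatypes.S n)); lra. }
  apply Rnot_lt_le; intros Hlt.
  destruct (fejer_cv f x Pf Cf (Rabs (f x) - S)) as [N HN]; [lra|].
  specialize (HN N (le_n N)); unfold R_dist in HN.
  assert (HN0 : 0 < INR (Datatypes.S N)) by (apply lt_0_INR; lia).
  assert (Hq : Rabs (sum_f_R0 (fun j => fourier_psum f j x) N / INR (Datatypes.S N)) <= S).
  { unfold Rdiv; rewrite Rabs_mult, Rabs_inv, (Rabs_pos_eq (INR _)) by lra.
    apply Rmult_le_reg_r with (INR (Datatypes.S N)); [exact HN0|].
    rewrite Rmult_assoc, Rinv_l, Rmult_1_r by lra; apply HS. }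
  rewrite Rabs_minus_sym in HN.
  generalize (Rabs_triang_inv (f x) (sum_f_R0 (fun j => fourier_psum f j x) N / INR (Datatypes.S N))).
  lra.
Qed.

Lemma fejer_series (f : R -> R) (x l : R) : periodic f -> cts f ->
  Un_cv (fun n => fourier_psum f n x) l -> f x = l.
Proof.
  intros Pf Cf H.
  apply UL_sequence with (fun n => sum_f_R0 (fun j => fourier_psum f j x) n / INR (S n)).
  - now apply fejer_cv.
  (* [Cesaro_1] divides the sum up to [pred n] by [n], so it is read at [S n]. *)
  - intros eps He; destruct (Cesaro_1 _ _ H eps He) as [N HN].
    exists N; intros n Hn; apply (HN (S n)); lia.
Qed.

(** * Fourier coefficients and the Sobolev bound *)

Lemma fourier_mode_split (f : R -> R) (k : nat) (x : R) : cts f ->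
  fourier_mode f k x = / (2 * PI) *
    (cos (INR k * x) * RInt (fun y => f y * cos (INR k * y)) (- PI) PI +
     sin (INR k * x) * RInt (fun y => f y * sin (INR k * y)) (- PI) PI).
Proof.
  intros Hf; unfold fourier_mode.
  rewrite (RInt_eq (fun y => f y * cos (INR k * (x - y)))
    (fun y => cos (INR k * x) * (f y * cos (INR k * y))
              + sin (INR k * x) * (f y * sin (INR k * y)))).
  - rewrite cRInt_plus, !cRInt_scal; auto 12 with cts.
  - intros y; rewrite Rmult_minus_distr_l, cos_minus; ring.
Qed.

Lemma Re_fourier_term (f : R -> R) (k : Z) (x : R) : cts f ->
  Re (RtoC (/ (1 + IZR k ^ 2)) * fourier f k * cexpi (IZR k * x))%C =
  / (1 + INR (Z.abs_nat k) ^ 2) * fourier_mode f (Z.abs_nat k) x.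
Proof.
  intros Hf; rewrite fourier_mode_split by exact Hf.
  rewrite INR_IZR_INZ, Zabs2Nat.id_abs, abs_IZR, pow2_abs, <- abs_IZR.
  generalize (/ (1 + IZR k ^ 2)); intros q.
  unfold fourier, cexpi, Cmult, RtoC, Re; simpl fst; simpl snd.
  destruct (Z.abs_spec k) as [[_ E]|[_ E]]; rewrite E.
  - ring.
  - rewrite opp_IZR.
    rewrite (RInt_eq (fun y => f y * cos (- IZR k * y)) (fun y => f y * cos (IZR k * y))).
    2: { intros y; rewrite <- cos_neg; do 2 f_equal; ring. }
    rewrite (RInt_eq (fun y => f y * sin (- IZR k * y))
      (fun y => (-1) * (f y * sin (IZR k * y)))).
    2: { intros y; replace (- IZR k * y) with (- (IZR k * y)) by ring.
         rewrite sin_neg; ring. }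
    rewrite cRInt_scal by auto 12 with cts.
    replace (- IZR k * x) with (- (IZR k * x)) by ring.
    rewrite cos_neg, sin_neg; simpl; ring.
Qed.

Lemma Cmod_sqr (z : C) : Cmod z ^ 2 = fst z ^ 2 + snd z ^ 2.
Proof. unfold Cmod; rewrite <- Rsqr_pow2, Rsqr_sqrt; [reflexivity | nra]. Qed.

(** Expand the nonnegative square [lam * w * (|m| - 1 / (lam * w))^2], with [m] the mode and
    [w = 1 + k^2], and bound [m^2] by the squared modulus of the coefficient. *)
Lemma fourier_mode_le (f : R -> R) (k : nat) (x lam : R) : cts f -> 0 < lam ->
  2 * Rabs (fourier_mode f k x)
  <= lam * H1_weight f (Z.of_nat k) + / lam * / (1 + INR k ^ 2).
Proof.
  intros Hf Hl; rewrite fourier_mode_split by exact Hf.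
  unfold H1_weight; rewrite Cmod_sqr, <- INR_IZR_INZ; unfold fourier; simpl fst; simpl snd.
  rewrite <- INR_IZR_INZ.
  set (a := RInt (fun y => f y * cos _) _ _); set (b := RInt (fun y => f y * sin _) _ _).
  generalize (sin2_cos2 (INR k * x)); unfold Rsqr.
  generalize (cos (INR k * x)) (sin (INR k * x)); intros c s Hcs.
  assert (Hk : 0 < 1 + INR k ^ 2) by (generalize (pow2_ge_0 (INR k)); lra).
  set (m := / (2 * PI) * (c * a + s * b)).
  set (w := 1 + INR k ^ 2) in *.
  set (q := (/ (2 * PI) * a) ^ 2 + (- (/ (2 * PI) * b)) ^ 2).
  assert (Hm : m ^ 2 <= q).
  { unfold m, q.
    replace ((/ (2 * PI) * (c * a + s * b)) ^ 2)
      with ((c * (/ (2 * PI) * a) + s * (/ (2 * PI) * b)) ^ 2) by ring.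
    generalize (/ (2 * PI) * a) (/ (2 * PI) * b); intros p r.
    (* Lagrange's identity: this is the gap in Cauchy-Schwarz for the unit vector [(c, s)]. *)
    assert (0 <= (c * r - s * p) ^ 2) by apply pow2_ge_0.
    replace (p ^ 2 + (- r) ^ 2) with ((s * s + c * c) * (p ^ 2 + r ^ 2)) by (rewrite Hcs; ring).
    nra. }
  rewrite <- Rinv_mult.
  assert (HW : 0 < lam * w) by nra.
  assert (Hp : 0 <= lam * w * (Rabs m - / (lam * w)) ^ 2).
  { apply Rmult_le_pos; [lra | apply pow2_ge_0]. }
  replace (lam * w * (Rabs m - / (lam * w)) ^ 2)
    with (lam * w * Rabs m ^ 2 - 2 * Rabs m + / (lam * w)) in Hp by (field; lra).
  rewrite pow2_abs in Hp.
  assert (lam * w * m ^ 2 <= lam * w * q) by (apply Rmult_le_compat_l; lra).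
  lra.
Qed.

Lemma sum_inv_1_plus_sqr (n : nat) :
  sum_f_R0 (fun k => / (1 + INR k ^ 2)) n <= 3.
Proof.
  (* Strengthened so that induction works: [1 / (1 + k^2) <= 2 / k - 2 / (k + 1)] for [k >= 1], with
     equality of the two sides of the claim at [n = 0]. *)
  apply Rle_trans with (3 - 2 / INR (S n)).
  - induction n as [|n IH].
    + simpl; lra.
    + rewrite tech5.
      assert (Hn := pos_INR n).
      rewrite !S_INR in *.
      assert (/ (1 + (INR n + 1) ^ 2) <= 2 / (INR n + 1) - 2 / (INR n + 1 + 1)).
      { apply Rminus_le.
        replace (/ (1 + (INR n + 1) ^ 2) - (2 / (INR n + 1) - 2 / (INR n + 1 + 1)))
          with (- ((INR n ^ 2 + INR n + 2) /
            ((1 + (INR n + 1) ^ 2) * (INR n + 1) * (INR n + 1 + 1)))).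
        - apply Ropp_le_cancel; rewrite Ropp_0, Ropp_involutive.
          apply Rmult_le_pos; [nra|].
          apply Rlt_le, Rinv_0_lt_compat; repeat apply Rmult_lt_0_compat; nra.
        - field; repeat split; nra. }
      lra.
  - assert (0 < / INR (S n)) by (apply Rinv_0_lt_compat, lt_0_INR; lia).
    lra.
Qed.

Lemma ex_series_inv_1_plus_sqr : ex_series (fun k => / (1 + INR k ^ 2)).
Proof.
  destruct (ex_finite_lim_seq_incr (sum_f_R0 (fun k => / (1 + INR k ^ 2))) 3) as [l Hl].
  - intros n; rewrite tech5.
    assert (0 < / (1 + INR (S n) ^ 2)).
    { apply Rinv_0_lt_compat; generalize (pow2_ge_0 (INR (S n))); lra. }
    lra.
  - apply sum_inv_1_plus_sqr.
  - exists l; apply is_series_Reals, is_lim_seq_Reals, Hl.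
Qed.

Lemma sum_le_Series (a : nat -> R) (n : nat) : (forall k, 0 <= a k) -> ex_series a ->
  sum_f_R0 a n <= Series a.
Proof.
  intros H E; apply sum_incr; [|exact H].
  now apply is_series_Reals, Series_correct.
Qed.

Lemma Series_nonneg (a : nat -> R) : (forall k, 0 <= a k) -> ex_series a -> 0 <= Series a.
Proof.
  intros H E; apply Rle_trans with (sum_f_R0 a 0); [apply H | now apply sum_le_Series].
Qed.

Lemma H1_weight_nonneg (f : R -> R) (k : Z) : 0 <= H1_weight f k.
Proof.
  unfold H1_weight; generalize (pow2_ge_0 (IZR k)) (pow2_ge_0 (Cmod (fourier f k))); nra.
Qed.

Lemma sum_H1_weight_le (f : R -> R) (n : nat) : zsummable (H1_weight f) ->
  sum_f_R0 (fun k => H1_weight f (Z.of_nat k)) n <= zsum (H1_weight f).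
Proof.
  intros [H1 H2]; unfold zsum.
  assert (A := sum_le_Series _ n (fun k => H1_weight_nonneg f (Z.of_nat k)) H1).
  assert (B := Series_nonneg _ (fun k => H1_weight_nonneg f (- Z.of_nat (S k))) H2).
  lra.
Qed.

(* Sobolev's embedding, with Cauchy-Schwarz replaced by AM-GM of parameter [lam]. *)
Lemma sup_le_H1 (f : R -> R) (x lam : R) : in_H1 f -> 0 < lam ->
  Rabs (f x) <= 3 / 2 * (lam * zsum (H1_weight f) + 3 / lam).
Proof.
  intros [Pf [Cf Sf]] Hl; apply fejer_bound; [exact Pf | exact Cf|]; intros n.
  assert (HA : 2 * sum_f_R0 (fun k => Rabs (fourier_mode f k x)) n
    <= lam * zsum (H1_weight f) + 3 / lam).
  { apply Rle_trans with (sum_f_R0 (fun k => lam * H1_weight f (Z.of_nat k)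
       + / lam * / (1 + INR k ^ 2)) n).
    - rewrite scal_sum; apply sum_Rle; intros k _.
      rewrite Rmult_comm; now apply fourier_mode_le.
    - rewrite sum_plus.
      rewrite (sum_eq (fun l => lam * H1_weight f (Z.of_nat l))
        (fun l => H1_weight f (Z.of_nat l) * lam)) by (intros; ring).
      rewrite (sum_eq (fun l => / lam * / (1 + INR l ^ 2))
        (fun l => / (1 + INR l ^ 2) * / lam)) by (intros; ring).
      rewrite <- !scal_sum.
      apply Rplus_le_compat.
      + apply Rmult_le_compat_l; [lra | now apply sum_H1_weight_le].
      + unfold Rdiv; rewrite (Rmult_comm 3).
        apply Rmult_le_compat_l; [apply Rlt_le, Rinv_0_lt_compat, Hl|].
        apply sum_inv_1_plus_sqr. }
  (* Twice the sum of the modes minus mode 0 is at most three times the sum of their absolute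
     values, and [HA] bounds twice that sum: hence the factor [3 / 2]. *)
  rewrite fourier_psum_eq by exact Cf.
  assert (HB := Rsum_abs (fun k => fourier_mode f k x) n).
  assert (HC : Rabs (fourier_mode f 0 x) <= sum_f_R0 (fun k => Rabs (fourier_mode f k x)) n).
  { clear; induction n as [|n IH]; [apply Rle_refl|].
    rewrite tech5; generalize (Rabs_pos (fourier_mode f (S n) x)); lra. }
  eapply Rle_trans; [apply Rabs_triang|].
  rewrite Rabs_Ropp, Rabs_mult, (Rabs_pos_eq 2); lra.
Qed.

(** Summability of the difference has to be secured before its [H1_norm] carries information, since
    [Series] is total and takes a value on divergent series too. It follows from
    [|a - b|^2 <= 2 |a|^2 + 2 |b|^2]. *)
Lemma in_H1_minus (f g : R -> R) : in_H1 f -> in_H1 g -> in_H1 (fun x => f x - g x).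
Proof.
  intros [Pf [Cf [Sf Sf']]] [Pg [Cg [Sg Sg']]]; split; [|split].
  - intros x; rewrite Pf, Pg; reflexivity.
  - now apply cts_minus.
  - assert (H : forall k, Rabs (H1_weight (fun x => f x - g x) k)
      <= 2 * H1_weight f k + 2 * H1_weight g k).
    { intros k; rewrite Rabs_pos_eq by apply H1_weight_nonneg.
      unfold H1_weight; rewrite !Cmod_sqr; unfold fourier; simpl fst; simpl snd.
      rewrite (RInt_eq (fun x => (f x - g x) * cos (IZR k * x))
        (fun x => f x * cos (IZR k * x) - g x * cos (IZR k * x))) by (intros; ring).
      rewrite (RInt_eq (fun x => (f x - g x) * sin (IZR k * x))
        (fun x => f x * sin (IZR k * x) - g x * sin (IZR k * x))) by (intros; ring).
      assert (Cf' : cts f) by exact Cf; assert (Cg' : cts g) by exact Cg.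
      rewrite !cRInt_minus by auto 12 with cts.
      rewrite !Rmult_minus_distr_l.
      generalize (/ (2 * PI) * RInt (fun x => f x * cos (IZR k * x)) (- PI) PI)
        (/ (2 * PI) * RInt (fun x => g x * cos (IZR k * x)) (- PI) PI)
        (/ (2 * PI) * RInt (fun x => f x * sin (IZR k * x)) (- PI) PI)
        (/ (2 * PI) * RInt (fun x => g x * sin (IZR k * x)) (- PI) PI).
      intros p q r s.
      assert (0 <= IZR k ^ 2) by apply pow2_ge_0.
      assert ((p - q) ^ 2 + (- (r - s)) ^ 2 <= 2 * (p ^ 2 + (- r) ^ 2) + 2 * (q ^ 2 + (- s) ^ 2)).
      { generalize (pow2_ge_0 (p + q)) (pow2_ge_0 (r + s)); nra. }
      replace (2 * ((1 + IZR k ^ 2) * (p ^ 2 + (- r) ^ 2)) + 2 * ((1 + IZR k ^ 2) * (q ^ 2 + (- s) ^ 2)))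
        with ((1 + IZR k ^ 2) * (2 * (p ^ 2 + (- r) ^ 2) + 2 * (q ^ 2 + (- s) ^ 2))) by ring.
      apply Rmult_le_compat_l; lra. }
    split.
    + apply (ex_series_le (V := R_CompleteNormedModule) _
        (fun n => 2 * H1_weight f (Z.of_nat n) + 2 * H1_weight g (Z.of_nat n))).
      * intros n; apply H.
      * apply (ex_series_plus (V := R_NormedModule)); now apply (ex_series_scal (V := R_NormedModule)).
    + apply (ex_series_le (V := R_CompleteNormedModule) _
        (fun n => 2 * H1_weight f (- Z.of_nat (S n)) + 2 * H1_weight g (- Z.of_nat (S n)))).
      * intros n; apply H.
      * apply (ex_series_plus (V := R_NormedModule)); now apply (ex_series_scal (V := R_NormedModule)).
Qed.

Lemma in_C_H1_uniform (u : R -> R -> R) (t0 eps : R) : in_C_H1 u -> 0 < eps ->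
  locally t0 (fun t => forall x, Rabs (u x t - u x t0) <= eps).
Proof.
  intros [Hu Cu] He.
  (* Chosen together with [lam = 9 / eps] below: both terms of the Sobolev bound become [eps / 3],
     and [3 / 2] of their sum is [eps]. The cap at 1 turns a bound on the norm [sqrt E] into one on
     [E]. *)
  set (d := Rmin 1 (eps ^ 2 / 27)).
  assert (Hd : 0 < d).
  { apply Rmin_pos; [lra|]; apply Rmult_lt_0_compat; [now apply pow_lt | lra]. }
  generalize (proj1 (filterlim_locally _ 0) (Cu t0) (mkposreal d Hd)).
  apply filter_imp; intros t Ht x.
  assert (HH : in_H1 (fun x => u x t - u x t0)) by (apply in_H1_minus; apply Hu).
  set (E := zsum (H1_weight (fun x => u x t - u x t0))).
  assert (HE : 0 <= E).
  { eapply Rle_trans; [|apply (sum_H1_weight_le _ 0); apply HH].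
    apply H1_weight_nonneg. }
  assert (HEd : E <= eps ^ 2 / 27).
  { change (Rabs (H1_norm (fun x => u x t - u x t0) - 0) < d) in Ht.
    rewrite Rminus_0_r in Ht; unfold H1_norm in Ht; fold E in Ht.
    rewrite Rabs_pos_eq in Ht by apply sqrt_pos.
    assert (H1 := Rmin_l 1 (eps ^ 2 / 27)); assert (H2 := Rmin_r 1 (eps ^ 2 / 27)).
    fold d in H1, H2.
    rewrite <- (sqrt_sqrt E HE).
    generalize (sqrt_pos E); nra. }
  eapply Rle_trans; [apply (sup_le_H1 _ x (9 / eps) HH)|].
  - apply Rmult_lt_0_compat; [lra | now apply Rinv_0_lt_compat].
  - fold E.
    assert (9 / eps * E <= 9 / eps * (eps ^ 2 / 27)).
    { apply Rmult_le_compat_l; [|exact HEd].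
      apply Rmult_le_pos; [lra | now apply Rlt_le, Rinv_0_lt_compat]. }
    replace (9 / eps * (eps ^ 2 / 27)) with (eps / 3) in H by (field; lra).
    replace (3 / (9 / eps)) with (eps / 3) by (field; lra).
    lra.
Qed.

(** The multiplier series converges absolutely, being dominated by [M / (1 + k^2)], and its partial
    sums are those of [g]; a convergent Fourier series of a continuous function can only converge to
    that function. *)
Lemma inv_one_minus_dxx_eq (f g : R -> R) (x : R) : periodic g -> cts g ->
  periodic f -> cts f ->
  (forall k, (1 + INR k ^ 2) * fourier_mode g k x = fourier_mode f k x) ->
  inv_one_minus_dxx f x = g x.
Proof.
  intros Pg Cg Pf Cf H.
  assert (Hk : forall k, 0 < 1 + INR k ^ 2).
  { intros k; generalize (pow2_ge_0 (INR k)); lra. }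
  set (a := fun k => / (1 + INR k ^ 2) * fourier_mode f k x).
  assert (Ha : ex_series a).
  { destruct (periodic_bounded f Pf Cf) as [M [HM B]].
    assert (Hpi := PI_RGT_0).
    apply (ex_series_le (V := R_CompleteNormedModule) _ (fun k => M * / (1 + INR k ^ 2))).
    - intros k; change (Rabs (a k) <= M * / (1 + INR k ^ 2)).
      unfold a; rewrite Rabs_mult, Rabs_pos_eq, Rmult_comm
        by (apply Rlt_le, Rinv_0_lt_compat, Hk).
      apply Rmult_le_compat_r; [apply Rlt_le, Rinv_0_lt_compat, Hk|].
      unfold fourier_mode.
      rewrite Rabs_mult, Rabs_pos_eq by (apply Rlt_le, Rinv_0_lt_compat; lra).
      apply Rmult_le_reg_l with (2 * PI); [lra|].
      rewrite <- Rmult_assoc, Rinv_r, Rmult_1_l by lra.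
      replace (2 * PI * M) with ((PI - - PI) * M) by ring.
      apply abs_RInt_le_const; [lra | apply cts_ex_RInt; auto 12 with cts |].
      intros t _; rewrite Rabs_mult, <- (Rmult_1_r M).
      apply Rmult_le_compat; auto using Rabs_pos; apply Rabs_le, COS_bound.
    - apply (ex_series_scal (V := R_NormedModule) M), ex_series_inv_1_plus_sqr. }
  (* The half over negative frequencies repeats [a] from index 1 on. *)
  assert (Hz : inv_one_minus_dxx f x = 2 * Series a - a 0%nat).
  { unfold inv_one_minus_dxx, zsum.
    rewrite (Series_ext _ a).
    2: { intros n; rewrite Re_fourier_term, Zabs2Nat.id by exact Cf; reflexivity. }
    rewrite (Series_ext (fun n => Re _) (fun n => a (S n))).
    2: { intros n; rewrite Re_fourier_term by exact Cf.
         replace (Z.abs_nat (- Z.of_nat (S n))) with (S n) by lia; reflexivity. }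
    rewrite (Series_incr_1 a Ha); ring. }
  rewrite Hz; symmetry; apply fejer_series; [exact Pg | exact Cg|].
  assert (HS : Un_cv (fun n => sum_f_R0 a n) (Series a)).
  { apply is_series_Reals, Series_correct, Ha. }
  intros eps He; destruct (HS (eps / 2)) as [N HN]; [lra|].
  exists N; intros n Hn; specialize (HN n Hn); unfold R_dist in *.
  rewrite fourier_psum_eq by exact Cg.
  assert (Hm : forall k, fourier_mode g k x = a k).
  { intros k; unfold a; rewrite <- H; field; apply Rgt_not_eq, Hk. }
  rewrite Hm, (sum_eq _ a) by (intros; apply Hm).
  replace (2 * sum_f_R0 a n - a 0%nat - (2 * Series a - a 0%nat))
    with (2 * (sum_f_R0 a n - Series a)) by ring.
  rewrite Rabs_mult, (Rabs_pos_eq 2); lra.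
Qed.

Lemma fourier_unique (f : R -> R) (x : R) : periodic f -> cts f ->
  (forall k, RInt (fun y => f y * cos (INR k * y)) (- PI) PI = 0) ->
  (forall k, RInt (fun y => f y * sin (INR k * y)) (- PI) PI = 0) -> f x = 0.
Proof.
  intros Pf Cf Hc Hs.
  assert (Hm : forall k, fourier_mode f k x = 0).
  { intros k; rewrite fourier_mode_split, Hc, Hs by exact Cf; eqR; ring. }
  assert (H : Rabs (f x) <= 0).
  { apply fejer_bound; [exact Pf | exact Cf|]; intros n.
    rewrite fourier_psum_eq, Hm, sum_eq_R0 by auto.
    rewrite Rmult_0_r, Rminus_0_r, Rabs_R0; apply Rle_refl. }
  generalize (Rabs_pos (f x)); intros H'.
  apply Rabs_eq_0; lra.
Qed.

(** * The Green function of [1 - d_x^2] *)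

Lemma is_derive_primitive (h : R -> R) (a x : R) : cts h ->
  is_derive (fun x => RInt h a x) x (h x).
Proof.
  intros Ch; apply (is_derive_RInt (V := R_NormedModule) h (fun x => RInt h a x) a x).
  - apply filter_forall; intros y; apply (RInt_correct (V := R_CompleteNormedModule)).
    now apply cts_ex_RInt.
  - apply Ch.
Qed.

(** Starting the period at [x] moves the kink of the Green function to the endpoints, so it enters
    only through the boundary terms of the derivative. *)
Definition window_RInt (h : R -> R) (x : R) : R := RInt h x (x + 2 * PI).

Lemma is_derive_window (h : R -> R) (x : R) : cts h ->
  is_derive (window_RInt h) x (h (x + 2 * PI) - h x).
Proof.
  intros Ch.
  apply (is_derive_ext (fun x => RInt h 0 (x + 2 * PI) - RInt h 0 x)).
  - intros t; unfold window_RInt.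
    rewrite <- (RInt_Chasles (V := R_CompleteNormedModule) h 0 t (t + 2 * PI))
      by now apply cts_ex_RInt.
    unfold plus; simpl; ring.
  - apply (is_derive_minus (V := R_NormedModule)); [|now apply is_derive_primitive].
    replace (h (x + 2 * PI)) with (scal 1 (h (x + 2 * PI)))
      by (unfold scal; simpl; unfold mult; simpl; ring).
    apply (is_derive_comp (V := R_NormedModule) (fun y => RInt h 0 y) (fun x => x + 2 * PI)).
    + now apply is_derive_primitive.
    + auto_derive; [trivial | reflexivity].
Qed.

(* The periodic solution of [g - g'' = f]: convolution with the Green function
   [cosh (s - pi) / (2 sinh pi)], [0 <= s <= 2 pi], split into exponentials. *)
Definition green (f : R -> R) (x : R) : R :=
  (exp (- x - PI) * window_RInt (fun y => exp y * f y) x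
   + exp (x + PI) * window_RInt (fun y => exp (- y) * f y) x)
  / (2 * (exp PI - exp (- PI))).

Definition green' (f : R -> R) (x : R) : R :=
  (- (exp (- x - PI) * window_RInt (fun y => exp y * f y) x)
   + exp (x + PI) * window_RInt (fun y => exp (- y) * f y) x)
  / (2 * (exp PI - exp (- PI))).

Lemma exp_PI_gap : 0 < exp PI - exp (- PI).
Proof. assert (exp (- PI) < exp PI) by (apply exp_increasing; generalize PI_RGT_0; lra). lra. Qed.

Lemma exp_mul (a b c : R) : a + b = c -> exp a * exp b = exp c.
Proof. intros <-; now rewrite exp_plus. Qed.

Section Green.

Variable f : R -> R.
Hypothesis Pf : periodic f.
Hypothesis Cf : cts f.

Lemma is_derive_exp_window (x : R) :
  is_derive (fun x => exp (- x - PI) * window_RInt (fun y => exp y * f y) x) x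
    (- (exp (- x - PI) * window_RInt (fun y => exp y * f y) x)
     + (exp PI - exp (- PI)) * f x).
Proof.
  assert (D := is_derive_window (fun y => exp y * f y) x ltac:(auto 12 with cts)).
  cbv beta in D; rewrite Pf in D.
  eapply is_derive_eq.
  - apply (is_derive_Rmult (fun x => exp (- x - PI))); [|exact D].
    auto_derive; [trivial | reflexivity].
  - rewrite Rmult_minus_distr_l, <- !Rmult_assoc.
    rewrite (exp_mul (- x - PI) (x + 2 * PI) PI), (exp_mul (- x - PI) x (- PI)) by ring.
    unfold Rminus; ring.
Qed.

Lemma is_derive_exp_neg_window (x : R) :
  is_derive (fun x => exp (x + PI) * window_RInt (fun y => exp (- y) * f y) x) x
    (exp (x + PI) * window_RInt (fun y => exp (- y) * f y) x
     - (exp PI - exp (- PI)) * f x).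
Proof.
  assert (D := is_derive_window (fun y => exp (- y) * f y) x ltac:(auto 12 with cts)).
  cbv beta in D; rewrite Pf in D.
  eapply is_derive_eq.
  - apply (is_derive_Rmult (fun x => exp (x + PI))); [|exact D].
    auto_derive; [trivial | reflexivity].
  - rewrite Rmult_minus_distr_l, <- !Rmult_assoc.
    rewrite (exp_mul (x + PI) (- (x + 2 * PI)) (- PI)), (exp_mul (x + PI) (- x) PI) by ring.
    ring.
Qed.

(** The boundary terms [(exp PI - exp (- PI)) * f x] of the two halves have opposite signs and
    cancel. In the second derivative they add up, and the normalisation turns them into [- f x]. *)
Lemma is_derive_green (x : R) : is_derive (green f) x (green' f x).
Proof.
  eapply is_derive_eq.
  - apply is_derive_Rdiv_const, is_derive_Rplus;
      [apply is_derive_exp_window | apply is_derive_exp_neg_window].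
  - unfold green'; f_equal; ring.
Qed.

Lemma is_derive_green' (x : R) : is_derive (green' f) x (green f x - f x).
Proof.
  eapply is_derive_eq.
  - apply is_derive_Rdiv_const, is_derive_Rplus; [|apply is_derive_exp_neg_window].
    apply is_derive_Ropp, is_derive_exp_window.
  - unfold green; generalize exp_PI_gap; intros HK; field; lra.
Qed.

Lemma cts_green : cts (green f).
Proof. apply (cts_deriv _ (green' f)), is_derive_green. Qed.

Lemma cts_green' : cts (green' f).
Proof. apply (cts_deriv _ (fun x => green f x - f x)), is_derive_green'. Qed.

(** The weighted integrands are not periodic but gain a constant factor over a period; the
    exponential in front of the window gains the inverse factor. *)
Lemma window_shift (h : R -> R) (a x : R) : cts h ->
  (forall y, h (y + 2 * PI) = a * h y) ->
  window_RInt h (x + 2 * PI) = a * window_RInt h x.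
Proof.
  intros Ch H; unfold window_RInt.
  rewrite <- cRInt_scal by exact Ch.
  assert (E := RInt_comp_lin (V := R_CompleteNormedModule) h 1 (2 * PI) x (x + 2 * PI)
    (cts_ex_RInt _ _ _ Ch)).
  rewrite !Rmult_1_l in E; rewrite <- E.
  apply RInt_eq; intros y; rewrite <- H.
  unfold scal; simpl; unfold mult; simpl; rewrite !Rmult_1_l; reflexivity.
Qed.

Lemma window_exp_shift (x : R) :
  exp (- (x + 2 * PI) - PI) * window_RInt (fun y => exp y * f y) (x + 2 * PI)
  = exp (- x - PI) * window_RInt (fun y => exp y * f y) x.
Proof.
  rewrite (window_shift _ (exp (2 * PI))).
  - rewrite <- Rmult_assoc, (exp_mul _ _ (- x - PI)) by ring; reflexivity.
  - auto 12 with cts.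
  - intros y; rewrite Pf, exp_plus; ring.
Qed.

Lemma window_exp_neg_shift (x : R) :
  exp (x + 2 * PI + PI) * window_RInt (fun y => exp (- y) * f y) (x + 2 * PI)
  = exp (x + PI) * window_RInt (fun y => exp (- y) * f y) x.
Proof.
  rewrite (window_shift _ (exp (- (2 * PI)))).
  - rewrite <- Rmult_assoc, (exp_mul _ _ (x + PI)) by ring; reflexivity.
  - auto 12 with cts.
  - intros y; rewrite Pf, Ropp_plus_distr, exp_plus; ring.
Qed.

Lemma periodic_green : periodic (green f).
Proof. intros x; unfold green; rewrite window_exp_shift, window_exp_neg_shift; reflexivity. Qed.

Lemma periodic_green' : periodic (green' f).
Proof. intros x; unfold green'; rewrite window_exp_shift, window_exp_neg_shift; reflexivity. Qed.

(** Two integrations by parts, done at once by integrating the exact derivatives of [g' e - g e1]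
    and [g e - g' e1] over a period, with [g = green f]. Keeping [e] abstract covers sines and
    cosines of both [k y] and [k (x - y)]. *)
Lemma RInt_green_mode (e e1 : R -> R) (q : R) :
  (forall x, is_derive e x (e1 x)) -> (forall x, is_derive e1 x (- q * e x)) ->
  periodic e -> periodic e1 ->
  (1 + q) * RInt (fun y => green f y * e y) (- PI) PI = RInt (fun y => f y * e y) (- PI) PI
  /\ (1 + q) * RInt (fun y => green' f y * e y) (- PI) PI
     = - RInt (fun y => f y * e1 y) (- PI) PI.
Proof.
  intros De De1 Pe Pe1.
  assert (Ce := cts_deriv _ _ De); assert (Ce1 := cts_deriv _ _ De1).
  assert (Cg := cts_green); assert (Cg' := cts_green').
  assert (HP : forall h, periodic h -> h PI = h (- PI)).
  { intros h Ph; rewrite <- (Ph (- PI)); f_equal; ring. }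
  assert (EPe := HP e Pe); assert (EPe1 := HP e1 Pe1).
  assert (EPg := HP _ periodic_green); assert (EPg' := HP _ periodic_green').
  split.
  - assert (H : RInt (fun y => (1 + q) * (green f y * e y) - f y * e y) (- PI) PI = 0).
    { rewrite (RInt_antideriv (fun y => green' f y * e y - green f y * e1 y)).
      - rewrite EPe, EPe1, EPg, EPg'; eqR; ring.
      - intros x; eapply is_derive_eq.
        + apply is_derive_Rminus; apply is_derive_Rmult;
            auto using is_derive_green, is_derive_green'.
        + simpl; ring.
      - auto 12 with cts. }
    rewrite cRInt_minus, cRInt_scal in H by auto 12 with cts; lra.
  - assert (H : RInt (fun y => (1 + q) * (green' f y * e y) + f y * e1 y) (- PI) PI = 0).
    { rewrite (RInt_antideriv (fun y => green f y * e y - green' f y * e1 y)).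
      - rewrite EPe, EPe1, EPg, EPg'; eqR; ring.
      - intros x; eapply is_derive_eq.
        + apply is_derive_Rminus; apply is_derive_Rmult;
            auto using is_derive_green, is_derive_green'.
        + simpl; ring.
      - auto 12 with cts. }
    rewrite cRInt_plus, cRInt_scal in H by auto 12 with cts; lra.
Qed.

Lemma inv_one_minus_dxx_green (x : R) : inv_one_minus_dxx f x = green f x.
Proof.
  apply inv_one_minus_dxx_eq; auto using periodic_green, cts_green.
  intros k; unfold fourier_mode.
  rewrite <- (proj1 (RInt_green_mode (fun y => cos (INR k * (x - y)))
    (fun y => INR k * sin (INR k * (x - y))) (INR k ^ 2)
    ltac:(intros y; auto_derive; [trivial | unfold Rminus; ring])
    ltac:(intros y; auto_derive; [trivial | unfold Rminus; ring])
    (periodic_reflect cos k x periodic_cos)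
    (fun y => f_equal (Rmult (INR k)) (periodic_reflect sin k x periodic_sin y)))).
  ring.
Qed.

End Green.

Lemma window_RInt_le (h : R -> R) (x M : R) : cts h ->
  (forall y, x <= y <= x + 2 * PI -> Rabs (h y) <= M) -> Rabs (window_RInt h x) <= 2 * PI * M.
Proof.
  intros Ch H; unfold window_RInt.
  replace (2 * PI * M) with ((x + 2 * PI - x) * M) by ring.
  apply abs_RInt_le_const; [generalize PI_RGT_0; lra | now apply cts_ex_RInt | exact H].
Qed.

Lemma green'_minus (f g : R -> R) (x : R) : cts f -> cts g ->
  green' (fun y => f y - g y) x = green' f x - green' g x.
Proof.
  intros Cf Cg; unfold green', window_RInt.
  rewrite (RInt_eq (fun y => exp y * (f y - g y))
    (fun y => exp y * f y - exp y * g y)) by (intros; ring).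
  rewrite (RInt_eq (fun y => exp (- y) * (f y - g y))
    (fun y => exp (- y) * f y - exp (- y) * g y)) by (intros; ring).
  rewrite !cRInt_minus by auto 12 with cts.
  field; generalize exp_PI_gap; lra.
Qed.

(** [K] can be taken independent of [x]: over the window the growing exponential is largest at
    [x + 2 PI], the decaying one at [x], and multiplied by its prefactor either gives [exp PI]. *)
Lemma green'_bound : exists K, 0 < K /\ forall (f : R -> R) (M x : R), cts f ->
  (forall y, Rabs (f y) <= M) -> Rabs (green' f x) <= K * M.
Proof.
  assert (HK := exp_PI_gap); assert (Hpi := PI_RGT_0).
  assert (HE : forall a, 0 < exp a) by apply exp_pos.
  exists (2 * (2 * PI * exp PI) / (2 * (exp PI - exp (- PI)))); split.
  - apply Rmult_lt_0_compat; [|apply Rinv_0_lt_compat; lra].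
    generalize (HE PI); nra.
  - intros f M x Cf B.
    assert (HM : 0 <= M) by (eapply Rle_trans; [apply Rabs_pos | apply (B 0)]).
    assert (H1 : Rabs (exp (- x - PI) * window_RInt (fun y => exp y * f y) x)
      <= 2 * PI * exp PI * M).
    { rewrite Rabs_mult, (Rabs_pos_eq (exp _)) by apply Rlt_le, HE.
      rewrite <- (exp_mul (- x - PI) (x + 2 * PI) PI) by ring.
      replace (2 * PI * (exp (- x - PI) * exp (x + 2 * PI)) * M)
        with (exp (- x - PI) * (2 * PI * (exp (x + 2 * PI) * M))) by ring.
      apply Rmult_le_compat_l; [apply Rlt_le, HE|].
      apply window_RInt_le; [auto 12 with cts|]; intros y Hy.
      rewrite Rabs_mult, (Rabs_pos_eq (exp _)) by apply Rlt_le, HE.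
      apply Rmult_le_compat; auto using Rabs_pos; [apply Rlt_le, HE|].
      destruct (Req_dec y (x + 2 * PI)) as [->|]; [apply Rle_refl|].
      apply Rlt_le, exp_increasing; lra. }
    assert (H2 : Rabs (exp (x + PI) * window_RInt (fun y => exp (- y) * f y) x)
      <= 2 * PI * exp PI * M).
    { rewrite Rabs_mult, (Rabs_pos_eq (exp _)) by apply Rlt_le, HE.
      rewrite <- (exp_mul (x + PI) (- x) PI) by ring.
      replace (2 * PI * (exp (x + PI) * exp (- x)) * M)
        with (exp (x + PI) * (2 * PI * (exp (- x) * M))) by ring.
      apply Rmult_le_compat_l; [apply Rlt_le, HE|].
      apply window_RInt_le; [auto 12 with cts|]; intros y Hy.
      rewrite Rabs_mult, (Rabs_pos_eq (exp _)) by apply Rlt_le, HE.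
      apply Rmult_le_compat; auto using Rabs_pos; [apply Rlt_le, HE|].
      destruct (Req_dec y x) as [->|]; [apply Rle_refl|].
      apply Rlt_le, exp_increasing; lra. }
    unfold green', Rdiv; rewrite Rabs_mult, (Rabs_pos_eq (/ _))
      by (apply Rlt_le, Rinv_0_lt_compat; lra).
    rewrite Rmult_assoc, (Rmult_comm (/ _) M), <- Rmult_assoc.
    apply Rmult_le_compat_r; [apply Rlt_le, Rinv_0_lt_compat; lra|].
    eapply Rle_trans; [apply Rabs_triang|]; rewrite Rabs_Ropp; lra.
Qed.

(** * Joint continuity and parametric integrals *)

Definition jcont (f : R -> R -> R) : Prop := forall x t, continuity_2d_pt f x t.

Lemma jcont_ext (f g : R -> R -> R) : (forall x t, f x t = g x t) -> jcont f -> jcont g.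
Proof. intros E H x t; now apply continuity_2d_pt_ext with f. Qed.

Lemma jcont_plus (f g : R -> R -> R) : jcont f -> jcont g -> jcont (fun x t => f x t + g x t).
Proof. intros Hf Hg x t; now apply continuity_2d_pt_plus. Qed.

Lemma jcont_mult (f g : R -> R -> R) : jcont f -> jcont g -> jcont (fun x t => f x t * g x t).
Proof. intros Hf Hg x t; now apply continuity_2d_pt_mult. Qed.

Lemma jcont_opp (f : R -> R -> R) : jcont f -> jcont (fun x t => - f x t).
Proof. intros Hf x t; now apply continuity_2d_pt_opp. Qed.

Lemma jcont_fst (f : R -> R) : cts f -> jcont (fun x _ => f x).
Proof.
  intros Cf x t eps.
  destruct (proj1 (filterlim_locally f (f x)) (Cf x) eps) as [d Hd].
  exists d; intros u v Hu _; now apply Hd.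
Qed.

Lemma jcont_swap (f : R -> R -> R) : jcont f -> jcont (fun t x => f x t).
Proof.
  intros H t x eps; destruct (H x t eps) as [d Hd].
  exists d; intros u v Hu Hv; now apply Hd.
Qed.

Lemma jcont_cts_snd (f : R -> R -> R) (x : R) : jcont f -> cts (f x).
Proof.
  intros H t; apply filterlim_locally; intros eps.
  destruct (H x t eps) as [d Hd]; exists d; intros y Hy.
  apply Hd; [rewrite Rminus_diag, Rabs_R0; apply cond_pos | exact Hy].
Qed.

Lemma jcont_cts_fst (f : R -> R -> R) (t : R) : jcont f -> cts (fun x => f x t).
Proof. intros H; apply (jcont_cts_snd (fun t x => f x t)); now apply jcont_swap. Qed.

(** Continuity of [t |-> f(., t)] in the sup norm. The Green operator is nonlocal in [x], and this
    form of continuity passes through it by linearity and [green'_bound]. *)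
Definition uniformly_cts (f : R -> R -> R) : Prop :=
  forall t0 eps, 0 < eps -> locally t0 (fun t => forall x, Rabs (f x t - f x t0) <= eps).

Lemma uniformly_cts_jcont (f : R -> R -> R) :
  (forall t, cts (fun x => f x t)) -> uniformly_cts f -> jcont f.
Proof.
  intros Cf Uf x t eps.
  assert (He := cond_pos eps).
  destruct (proj1 (filterlim_locally _ _) (Cf t x) (mkposreal (eps / 2) ltac:(lra))) as [d1 H1].
  destruct (Uf t (eps / 2)) as [d2 H2]; [lra|].
  exists (mkposreal _ (Rmin_stable_in_posreal d1 d2)); simpl; intros u v Hu Hv.
  assert (A := H2 v (Rlt_le_trans _ _ _ Hv (Rmin_r _ _)) u).
  assert (B := H1 u (Rlt_le_trans _ _ _ Hu (Rmin_l _ _))).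
  change (Rabs (f u t - f x t) < eps / 2) in B.
  replace (f u v - f x t) with (f u v - f u t + (f u t - f x t)) by ring.
  eapply Rle_lt_trans; [apply Rabs_triang | lra].
Qed.

Lemma cts_RInt_param (f : R -> R -> R) (a b : R) : jcont f ->
  cts (fun t => RInt (fun x => f x t) a b).
Proof.
  intros Jf; revert a b.
  assert (Main : forall a b, a <= b -> cts (fun t => RInt (fun x => f x t) a b)).
  2: { intros a b; destruct (Rle_lt_dec a b) as [H|H]; [now apply Main|].
       apply (cts_ext (fun t => - RInt (fun x => f x t) b a)).
       - intros t; apply (opp_RInt_swap (V := R_CompleteNormedModule)).
         now apply cts_ex_RInt, jcont_cts_fst.
       - apply cts_opp, Main; lra. }
  intros a b Hab t0; apply filterlim_locally; intros eps.
  assert (He := cond_pos eps).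
  (* The [+ 1] guards against [a = b]; the factor 2 makes the final inequality strict. *)
  assert (Hq : 0 < eps / (2 * (b - a + 1))) by (apply Rdiv_lt_0_compat; lra).
  destruct (uniform_continuity_2d_1d f a b t0 (fun x _ => Jf x t0) (mkposreal _ Hq)) as [d Hd].
  assert (Hd0 := cond_pos d).
  exists d; intros t Ht.
  change (Rabs (RInt (fun x => f x t) a b - RInt (fun x => f x t0) a b) < eps).
  change (Rabs (t - t0) < d) in Ht; apply Rabs_def2 in Ht.
  rewrite <- cRInt_minus by now apply jcont_cts_fst.
  apply Rle_lt_trans with ((b - a) * (eps / (2 * (b - a + 1)))).
  - apply abs_RInt_le_const; [exact Hab | |].
    + apply cts_ex_RInt; apply cts_minus; now apply jcont_cts_fst.
    + intros x Hx; apply Rlt_le, (Hd x t0 x t); try lra.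
      rewrite Rminus_diag, Rabs_R0; exact Hd0.
  - replace ((b - a) * (eps / (2 * (b - a + 1)))) with (eps * ((b - a) / (b - a + 1) / 2))
      by (field; lra).
    assert ((b - a) / (b - a + 1) <= 1).
    { apply Rmult_le_reg_r with (b - a + 1); [lra|].
      unfold Rdiv; rewrite Rmult_assoc, Rinv_l; lra. }
    nra.
Qed.

Lemma is_derive_RInt_parameter (f df : R -> R -> R) (a b t : R) :
  (forall x t, is_derive (fun s => f x s) t (df x t)) -> jcont df ->
  (forall t, cts (fun x => f x t)) ->
  is_derive (fun s => RInt (fun x => f x s) a b) t (RInt (fun x => df x t) a b).
Proof.
  intros D J Cf.
  assert (E : forall x t, Derive (fun s => f x s) t = df x t)
    by (intros; apply is_derive_unique, D).
  rewrite (RInt_eq (fun x => df x t) (fun x => Derive (fun s => f x s) t)) by (intros; now rewrite E).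
  apply (is_derive_RInt_param (fun s x => f x s) a b t).
  - apply filter_forall; intros s x _; exists (df x s); apply D.
  - intros x _; apply continuity_2d_pt_ext with (fun t x => df x t).
    + intros; now rewrite E.
    + now apply (jcont_swap df).
  - apply filter_forall; intros s; now apply cts_ex_RInt.
Qed.

(** * Smooth functions and the du Bois-Reymond lemma *)

(** Carrying the derivatives as witnesses makes closure under products a plain induction, without a
    Leibniz formula. *)
Fixpoint smooth_n (n : nat) (f : R -> R) : Prop :=
  match n with
  | O => cts f
  | S m => exists df, (forall x, is_derive f x (df x)) /\ smooth_n m df
  end.

Definition smooth (f : R -> R) : Prop := forall n, smooth_n n f.

Lemma smooth_n_cts (n : nat) (f : R -> R) : smooth_n n f -> cts f.
Proof. destruct n; [trivial|]; intros [df [D _]]; exact (cts_deriv f df D). Qed.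

Lemma smooth_n_pred (n : nat) (f : R -> R) : smooth_n (S n) f -> smooth_n n f.
Proof.
  revert f; induction n as [|n IH]; intros f [df [D S]].
  - exact (cts_deriv f df D).
  - exists df; auto.
Qed.

Lemma smooth_n_plus (n : nat) (f g : R -> R) : smooth_n n f -> smooth_n n g ->
  smooth_n n (fun x => f x + g x).
Proof.
  revert f g; induction n as [|n IH]; intros f g.
  - apply cts_plus.
  - intros [df [Df Sf]] [dg [Dg Sg]]; exists (fun x => df x + dg x); split; auto.
    intros x; now apply is_derive_Rplus.
Qed.

Lemma smooth_n_const (n : nat) (a : R) : smooth_n n (fun _ => a).
Proof.
  revert a; induction n as [|n IH]; intros a; [apply cts_const|].
  exists (fun _ => 0); split; [intros x; apply (is_derive_const (V := R_NormedModule)) | apply IH].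
Qed.

Lemma smooth_n_mult (n : nat) (f g : R -> R) : smooth_n n f -> smooth_n n g ->
  smooth_n n (fun x => f x * g x).
Proof.
  revert f g; induction n as [|n IH]; intros f g.
  - apply cts_mult.
  - intros Hf Hg; assert (Hf' := smooth_n_pred _ _ Hf); assert (Hg' := smooth_n_pred _ _ Hg).
    destruct Hf as [df [Df Sf]]; destruct Hg as [dg [Dg Sg]].
    exists (fun x => df x * g x + f x * dg x); split.
    + intros x; now apply is_derive_Rmult.
    + apply smooth_n_plus; now apply IH.
Qed.

Lemma is_derive_affine (f : R -> R) (a b x df : R) : is_derive f (a * x + b) df ->
  is_derive (fun y => f (a * y + b)) x (a * df).
Proof.
  intros D; apply (is_derive_comp (V := R_NormedModule) f (fun y => a * y + b) x df a D).
  auto_derive; [trivial | ring].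
Qed.

Lemma smooth_n_affine (n : nat) (f : R -> R) (a b : R) : smooth_n n f ->
  smooth_n n (fun x => f (a * x + b)).
Proof.
  revert f; induction n as [|n IH]; intros f.
  - intros Cf; apply (cts_comp (fun x => a * x + b) f); auto 12 with cts.
  - intros [df [D S]]; exists (fun x => a * df (a * x + b)); split.
    + intros x; now apply is_derive_affine.
    + apply smooth_n_mult; [apply smooth_n_const | now apply IH].
Qed.

Lemma smooth_plus (f g : R -> R) : smooth f -> smooth g -> smooth (fun x => f x + g x).
Proof. intros Hf Hg n; now apply smooth_n_plus. Qed.

Lemma smooth_mult (f g : R -> R) : smooth f -> smooth g -> smooth (fun x => f x * g x).
Proof. intros Hf Hg n; now apply smooth_n_mult. Qed.

Lemma smooth_affine (f : R -> R) (a b : R) : smooth f -> smooth (fun x => f (a * x + b)).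
Proof. intros Hf n; now apply smooth_n_affine. Qed.

Lemma smooth_primitive (f df : R -> R) : (forall x, is_derive f x (df x)) -> smooth df -> smooth f.
Proof.
  intros D S [|n]; [exact (cts_deriv f df D) | exists df; split; [exact D | apply S]].
Qed.

Lemma smooth_n_trig (n : nat) (k : R) :
  smooth_n n (fun x => cos (k * x)) /\ smooth_n n (fun x => sin (k * x)).
Proof.
  induction n as [|n [IHc IHs]]; [split; simpl; auto 12 with cts|].
  split.
  - exists (fun x => - k * sin (k * x)); split.
    + intros x; auto_derive; [trivial | ring].
    + apply smooth_n_mult; [apply smooth_n_const | exact IHs].
  - exists (fun x => k * cos (k * x)); split.
    + intros x; auto_derive; [trivial | ring].
    + apply smooth_n_mult; [apply smooth_n_const | exact IHc].
Qed.

(** * A compactly supported smooth bump *)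

Definition flat (m : nat) (t : R) : R :=
  if Rlt_dec 0 t then exp (- / t) * (/ t) ^ m else 0.

Lemma flat_neg (m : nat) (t : R) : t <= 0 -> flat m t = 0.
Proof. intros H; unfold flat; destruct (Rlt_dec 0 t); [lra | reflexivity]. Qed.

Lemma flat_pos (m : nat) (t : R) : 0 < t -> flat m t = exp (- / t) * (/ t) ^ m.
Proof. intros H; unfold flat; destruct (Rlt_dec 0 t); [reflexivity | lra]. Qed.

(** For [n > 0], raise [s = n * (s / n) <= n * exp (s / n)] to the power [n]. *)
Lemma pow_le_exp (n : nat) (s : R) : 0 <= s -> s ^ n <= INR n ^ n * exp s.
Proof.
  intros Hs; destruct n as [|n].
  - simpl; generalize (exp_ineq1_le s); lra.
  - assert (Hn : 0 < INR (S n)) by (apply lt_0_INR; lia).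
    assert (E : forall m, exp (INR m * (s / INR (S n))) = exp (s / INR (S n)) ^ m).
    { induction m as [|m IH]; [simpl; rewrite Rmult_0_l; apply exp_0|].
      rewrite S_INR, Rmult_plus_distr_r, Rmult_1_l, exp_plus, IH; simpl; ring. }
    replace (exp s) with (exp (INR (S n) * (s / INR (S n)))) by (f_equal; field; lra).
    rewrite E, <- Rpow_mult_distr.
    apply pow_incr; split; [exact Hs|].
    apply Rle_trans with (INR (S n) * (s / INR (S n))); [right; field; lra|].
    apply Rmult_le_compat_l; [lra|].
    generalize (exp_ineq1_le (s / INR (S n))); lra.
Qed.

(** Quadratic smallness at 0 is what makes the difference quotient there vanish. Two more powers of
    [1 / t] than in [flat m] are absorbed by the exponential. *)
Lemma flat_bound (m : nat) (t : R) : Rabs (flat m t) <= INR (m + 2) ^ (m + 2) * t ^ 2.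
Proof.
  assert (HC : 0 <= INR (m + 2) ^ (m + 2)) by apply pow_le, pos_INR.
  destruct (Rlt_le_dec 0 t) as [Ht|Ht].
  - rewrite flat_pos by exact Ht.
    assert (Hi : 0 < / t) by now apply Rinv_0_lt_compat.
    rewrite Rabs_pos_eq.
    2: { apply Rmult_le_pos; [apply Rlt_le, exp_pos | apply pow_le; lra]. }
    assert (H := pow_le_exp (m + 2) (/ t) (Rlt_le _ _ Hi)).
    rewrite exp_Ropp.
    apply Rmult_le_reg_l with (exp (/ t)); [apply exp_pos|].
    rewrite <- Rmult_assoc, Rinv_r, Rmult_1_l by apply Rgt_not_eq, exp_pos.
    apply Rmult_le_compat_r with (r := t ^ 2) in H; [|apply pow2_ge_0].
    rewrite Rdef_pow_add in H.
    replace ((/ t) ^ m * (/ t) ^ 2 * t ^ 2) with ((/ t) ^ m) in H by (simpl; field; lra).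
    lra.
  - rewrite flat_neg, Rabs_R0 by exact Ht.
    apply Rmult_le_pos; [exact HC | apply pow2_ge_0].
Qed.

(** The powers of [1 / t] are part of the family so that it is closed under differentiation;
    smoothness of all members then follows by one induction. *)
Lemma is_derive_flat (m : nat) (t : R) :
  is_derive (flat m) t (flat (m + 2) t + - INR m * flat (m + 1) t).
Proof.
  destruct (Rtotal_order t 0) as [Ht|[->|Ht]].
  - rewrite !flat_neg by lra.
    apply (is_derive_ext_loc (fun _ => 0)).
    + exists (mkposreal (- t) ltac:(lra)); intros y Hy.
      change (Rabs (y - t) < - t) in Hy; apply Rabs_def2 in Hy.
      rewrite flat_neg; [reflexivity | lra].
    + eapply is_derive_eq; [apply (is_derive_const (V := R_NormedModule))|].
      unfold zero; simpl; ring.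
  - rewrite !flat_neg by lra.
    apply is_derive_Reals; intros eps He.
    set (C := INR (m + 2) ^ (m + 2)).
    assert (HC : 0 <= C) by apply pow_le, pos_INR.
    assert (Hd : 0 < eps / (C + 1)) by (apply Rdiv_lt_0_compat; lra).
    exists (mkposreal _ Hd); simpl; intros h Hh Hlt.
    rewrite (flat_neg m 0), Rplus_0_l by lra.
    replace ((flat m h - 0) / h - (0 + - INR m * 0)) with (flat m h * / h) by (field; exact Hh).
    rewrite Rabs_mult, Rabs_inv.
    assert (Hh' : 0 < Rabs h) by now apply Rabs_pos_lt.
    apply Rle_lt_trans with (C * Rabs h).
    + apply Rmult_le_reg_r with (Rabs h); [exact Hh'|].
      rewrite Rmult_assoc, Rinv_l, Rmult_1_r by lra.
      eapply Rle_trans; [apply flat_bound|]; fold C.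
      rewrite <- (pow2_abs h); simpl; lra.
    + apply Rle_lt_trans with ((C + 1) * Rabs h); [nra|].
      apply Rmult_lt_reg_r with (/ (C + 1)); [apply Rinv_0_lt_compat; lra|].
      replace ((C + 1) * Rabs h * / (C + 1)) with (Rabs h) by (field; lra); exact Hlt.
  - rewrite !flat_pos by lra.
    apply (is_derive_ext_loc (fun t => exp (- / t) * (/ t) ^ m)).
    + exists (mkposreal t Ht); intros y Hy.
      change (Rabs (y - t) < t) in Hy; apply Rabs_def2 in Hy.
      rewrite flat_pos; [reflexivity | lra].
    + auto_derive; [repeat split; lra|].
      (* The power rule leaves [pred m], so [m = 0] is treated apart. *)
      rewrite !Rdef_pow_add; destruct m as [|m]; [simpl; field; lra|].
      simpl pred; rewrite <- (tech_pow_Rmult (/ t) m); field; lra.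
Qed.

Lemma smooth_flat (m : nat) : smooth (flat m).
Proof.
  intros n; revert m; induction n as [|n IH]; intros m.
  - exact (cts_deriv _ _ (is_derive_flat m)).
  - exists (fun t => flat (m + 2) t + - INR m * flat (m + 1) t); split.
    + apply is_derive_flat.
    + apply smooth_n_plus; [apply IH|].
      apply smooth_n_mult; [apply smooth_n_const | apply IH].
Qed.

Lemma exists_bump (eps : R) : 0 < eps -> exists rho : R -> R,
  smooth rho /\ (forall t, 0 <= rho t) /\ (forall t, t <= 0 \/ eps <= t -> rho t = 0) /\
  0 < RInt rho 0 eps.
Proof.
  intros He.
  assert (Hp : forall t, 0 < t -> 0 < flat 0 t).
  { intros t Ht; rewrite flat_pos by exact Ht; simpl; rewrite Rmult_1_r; apply exp_pos. }
  assert (Hp' : forall t, 0 <= flat 0 t).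
  { intros t; destruct (Rlt_le_dec 0 t) as [H|H]; [now apply Rlt_le, Hp|].
    rewrite flat_neg by exact H; apply Rle_refl. }
  set (rho := fun t => flat 0 t * flat 0 (-1 * t + eps)).
  assert (S : smooth rho) by (apply smooth_mult; [|apply smooth_affine]; apply smooth_flat).
  exists rho; repeat split.
  - exact S.
  - intros t; now apply Rmult_le_pos.
  - intros t [H|H]; unfold rho.
    + rewrite flat_neg by exact H; ring.
    + rewrite (flat_neg 0 (-1 * t + eps)) by lra; ring.
  - apply RInt_gt_0; [exact He | |].
    + intros t Ht; apply Rmult_lt_0_compat; apply Hp; lra.
    + intros t _; apply (S 0%nat).
Qed.

(** * A weak derivative that is continuous is a classical one *)

Section DuBoisReymond.

Variables A B : R -> R.
Hypothesis CA : cts A.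
Hypothesis CB : cts B.
Hypothesis weak : forall (T : R) (chi chi' : R -> R), 0 < T -> smooth chi ->
  (forall t, is_derive chi t (chi' t)) -> (forall t, T <= Rabs t -> chi t = 0) ->
  RInt (fun t => A t * chi' t + B t * chi t) (- T) T = 0.

(** Has zero weak derivative, so the claim reduces to [G] being constant. *)
Let G (t : R) : R := A t - RInt B 0 t.

Lemma cts_G : cts G.
Proof.
  apply cts_minus; [exact CA|].
  apply (cts_deriv (fun t => RInt B 0 t) B); intros; now apply is_derive_primitive.
Qed.

Lemma weak_G (T : R) (chi chi' : R -> R) : 0 < T -> smooth chi ->
  (forall t, is_derive chi t (chi' t)) -> cts chi' -> (forall t, T <= Rabs t -> chi t = 0) ->
  RInt (fun t => G t * chi' t) (- T) T = 0.
Proof.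
  intros HT S D C' Z.
  assert (Cchi := S 0%nat : cts chi); assert (CG := cts_G).
  assert (DI : forall t, is_derive (fun t => RInt B 0 t) t (B t))
    by (intros; now apply is_derive_primitive).
  assert (CI := cts_deriv _ _ DI).
  assert (W := weak T chi chi' HT S D Z).
  rewrite (RInt_eq (fun t => A t * chi' t + B t * chi t)
    (fun t => G t * chi' t + (B t * chi t + RInt B 0 t * chi' t))) in W
    by (intros; unfold G; ring).
  rewrite cRInt_plus in W by auto 12 with cts.
  rewrite (RInt_antideriv (fun t => RInt B 0 t * chi t)
    (fun t => B t * chi t + RInt B 0 t * chi' t)) in W; auto 12 with cts.
  - cbv beta in W; rewrite !Z in W; [eqR; lra | |]; rewrite ?Rabs_Ropp; apply Rle_abs.
  - intros t; now apply is_derive_Rmult.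
Qed.

(** The difference of two translates of a bump is the derivative of a compactly supported function,
    so [G] has the same average near [s1] as near [s2]. *)
Lemma G_not_lt (s1 s2 : R) : ~ G s1 < G s2.
Proof.
  intros Hlt.
  (* With a third of the gap, [G] stays below [G s1 + d] near [s1] and above [G s2 - d] near [s2],
     and these bounds remain apart. *)
  set (d := (G s2 - G s1) / 3).
  assert (Hd : 0 < d) by (unfold d; lra).
  destruct (proj1 (filterlim_locally _ _) (cts_G s1) (mkposreal d Hd)) as [e1 H1].
  destruct (proj1 (filterlim_locally _ _) (cts_G s2) (mkposreal d Hd)) as [e2 H2].
  set (eps := Rmin e1 e2).
  assert (He : 0 < eps) by (apply Rmin_pos; apply cond_pos).
  destruct (exists_bump eps He) as [rho [S [P [Z I]]]].
  assert (Crho := S 0%nat : cts rho).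
  (* Translates are written [1 * t + - s] to match the shape in [smooth_affine]. *)
  assert (Csh : forall s, cts (fun t => rho (1 * t + - s))).
  { intros s; apply (cts_comp (fun t => 1 * t + - s) rho); auto 12 with cts. }
  set (Q := fun t => RInt rho 0 t).
  assert (DQ : forall t, is_derive Q t (rho t)) by (intros; now apply is_derive_primitive).
  assert (DQs : forall s t, is_derive (fun t => Q (1 * t + - s)) t (rho (1 * t + - s))).
  { intros s t; eapply is_derive_eq; [apply is_derive_affine, DQ | ring]. }
  assert (Q0 : forall t, t <= 0 -> Q t = 0).
  { intros t Ht; unfold Q.
    rewrite <- (opp_RInt_swap (V := R_CompleteNormedModule)) by now apply cts_ex_RInt.
    rewrite (RInt_ext (V := R_CompleteNormedModule) rho (fun _ => 0)).
    - rewrite RInt_cst; unfold opp; simpl; ring.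
    - intros x; rewrite Rmin_left, Rmax_right by exact Ht; intros Hx; apply Z; lra. }
  assert (Qe : forall t, eps <= t -> Q t = Q eps).
  { intros t Ht; unfold Q.
    rewrite <- (RInt_Chasles (V := R_CompleteNormedModule) rho 0 eps t) by now apply cts_ex_RInt.
    rewrite (RInt_ext (V := R_CompleteNormedModule) rho (fun _ => 0) eps t).
    - rewrite RInt_cst; unfold plus; simpl; ring.
    - intros x; rewrite Rmin_left, Rmax_right by exact Ht; intros Hx; apply Z; lra. }
  (* Outside [(- T, T)] both translated primitives are 0 on the left and [Q eps] on the right, so
     their difference vanishes. *)
  set (T := Rabs s1 + Rabs s2 + eps).
  assert (B1 := Rabs_pos s1); assert (B2 := Rabs_pos s2).
  assert (B1' := Rle_abs s1); assert (B2' := Rle_abs s2).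
  assert (B1'' := Rle_abs (- s1)); assert (B2'' := Rle_abs (- s2)).
  rewrite Rabs_Ropp in B1'', B2''.
  assert (HT : 0 < T) by (unfold T; lra).
  assert (W := weak_G T (fun t => Q (1 * t + - s1) + -1 * Q (1 * t + - s2))
    (fun t => rho (1 * t + - s1) + -1 * rho (1 * t + - s2)) HT).
  assert (CG := cts_G).
  assert (Hc : forall s, Rabs s <= Rabs s1 + Rabs s2 ->
    RInt (fun t => rho (1 * t + - s)) (- T) T = Q eps).
  { intros s Hs; rewrite (RInt_antideriv (fun t => Q (1 * t + - s))); auto.
    assert (C1 := Rle_abs s); assert (C2 := Rle_abs (- s)); rewrite Rabs_Ropp in C2.
    rewrite (Qe (1 * T + - s)), (Q0 (1 * - T + - s)) by (unfold T; lra); eqR; ring. }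
  assert (Hab : RInt (fun t => G t * rho (1 * t + - s1)) (- T) T
    = RInt (fun t => G t * rho (1 * t + - s2)) (- T) T).
  { apply Rminus_diag_uniq; rewrite <- cRInt_minus by auto 12 with cts.
    rewrite <- W.
    - apply RInt_eq; intros; ring.
    - apply smooth_plus; [|apply smooth_mult; [intros n; apply smooth_n_const|]];
        apply smooth_affine; now apply (smooth_primitive Q rho).
    - intros t; apply is_derive_Rplus; [apply DQs|].
      apply (is_derive_scal (fun t => Q (1 * t + - s2)) t (-1)), DQs.
    - auto 12 with cts.
    - intros t Ht; unfold Rabs in Ht; destruct (Rcase_abs t).
      + rewrite (Q0 (1 * t + - s1)), (Q0 (1 * t + - s2)) by (unfold T in Ht; lra); ring.
      + rewrite (Qe (1 * t + - s1)), (Qe (1 * t + - s2)) by (unfold T in Ht; lra); ring. }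
  assert (L : RInt (fun t => G t * rho (1 * t + - s1)) (- T) T <= (G s1 + d) * Q eps).
  { rewrite <- (Hc s1), <- cRInt_scal by (auto; lra).
    apply RInt_le; [lra | apply cts_ex_RInt; auto 12 with cts
      | apply cts_ex_RInt; auto 12 with cts |].
    (* Either [t] is within [eps] of [s1], where the bound on [G] holds, or the bump is zero and
       both sides vanish. *)
    intros t _; destruct (Rlt_le_dec 0 (1 * t + - s1)) as [K1|K1].
    - destruct (Rlt_le_dec (1 * t + - s1) eps) as [K2|K2].
      + apply Rmult_le_compat_r; [apply P|].
        assert (K3 : Rabs (t - s1) < e1).
        { apply Rabs_def1; generalize (Rmin_l e1 e2); fold eps; lra. }
        specialize (H1 t K3); change (Rabs (G t - G s1) < d) in H1.
        apply Rabs_def2 in H1; lra.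
      + rewrite Z by (right; exact K2); lra.
    - rewrite Z by (left; exact K1); lra. }
  assert (U : (G s2 - d) * Q eps <= RInt (fun t => G t * rho (1 * t + - s2)) (- T) T).
  { rewrite <- (Hc s2), <- cRInt_scal by (auto; lra).
    apply RInt_le; [lra | apply cts_ex_RInt; auto 12 with cts
      | apply cts_ex_RInt; auto 12 with cts |].
    intros t _; destruct (Rlt_le_dec 0 (1 * t + - s2)) as [K1|K1].
    - destruct (Rlt_le_dec (1 * t + - s2) eps) as [K2|K2].
      + apply Rmult_le_compat_r; [apply P|].
        assert (K3 : Rabs (t - s2) < e2).
        { apply Rabs_def1; generalize (Rmin_r e1 e2); fold eps; lra. }
        specialize (H2 t K3); change (Rabs (G t - G s2) < d) in H2.
        apply Rabs_def2 in H2; lra.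
      + rewrite Z by (right; exact K2); lra.
    - rewrite Z by (left; exact K1); lra. }
  change (0 < Q eps) in I.
  assert (G s1 + d < G s2 - d) by (unfold d; lra).
  nra.
Qed.

Lemma du_bois_reymond (t : R) : is_derive A t (B t).
Proof.
  apply (is_derive_ext (fun t => G 0 + RInt B 0 t)).
  - intros s; replace (G 0) with (G s).
    + unfold G; eqR; ring.
    + destruct (Rtotal_order (G s) (G 0)) as [H|[H|H]]; [|exact H|].
      * now apply G_not_lt in H.
      * now apply G_not_lt in H.
  - eapply is_derive_eq; [apply is_derive_Rplus|].
    + apply (is_derive_const (V := R_NormedModule)).
    + now apply is_derive_primitive.
    + unfold zero; simpl; ring.
Qed.

End DuBoisReymond.

(** * The evolution equation *)

(** Both partial derivatives are again products of this kind. [ex_diff_n] recurses on the derivative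
    as a function, which is why extensionality is invoked. *)
Lemma ex_diff_n_product (n : nat) (e chi : R -> R) (x t : R) :
  smooth_n n e -> smooth_n n chi -> ex_diff_n (fun x t => e x * chi t) n x t.
Proof.
  revert e chi; induction n as [|n IH]; intros e chi He Hchi;
    assert (J : continuity_2d_pt (fun x t => e x * chi t) x t)
      by (apply (jcont_mult (fun x _ => e x) (fun _ t => chi t));
          [|apply (jcont_swap (fun t _ => chi t))]; apply jcont_fst; eapply smooth_n_cts; eassumption).
  - split; [exact J | trivial].
  - assert (He' := smooth_n_pred _ _ He); assert (Hchi' := smooth_n_pred _ _ Hchi).
    destruct He as [de [De Se]]; destruct Hchi as [dchi [Dchi Schi]].
    assert (D1 : forall u v, is_derive (fun z => e z * chi v) u (de u * chi v))
      by (intros; now apply is_derive_Rmult_const).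
    assert (D2 : forall u v, is_derive (fun z => e u * chi z) v (e u * dchi v))
      by (intros; now apply is_derive_Rconst_mult).
    split; [exact J|]; split; [|split; [|split]].
    + exists (de x * chi t); apply D1.
    + exists (e x * dchi t); apply D2.
    + replace (fun u v => Derive (fun z => e z * chi v) u) with (fun u v => de u * chi v).
      * now apply IH.
      * extensionality u; extensionality v; symmetry; apply is_derive_unique, D1.
    + replace (fun u v => Derive (fun z => e u * chi z) v) with (fun u v => e u * dchi v).
      * now apply IH.
      * extensionality u; extensionality v; symmetry; apply is_derive_unique, D2.
Qed.

(** On test functions [e(x) chi(t)] with [e'' = - q e] the equation is a weak ordinary differential
    equation in [t], since [(1 - d_x^2) e = (1 + q) e]; du Bois-Reymond makes it classical. *)
Lemma is_derive_mode (u : R -> R -> R) (e e1 : R -> R) (q t : R) :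
  jcont u -> distributional_solution u -> smooth e ->
  (forall x, is_derive e x (e1 x)) -> (forall x, is_derive e1 x (- q * e x)) -> periodic e ->
  is_derive (fun t => (1 + q) * RInt (fun x => u x t * e x) (- PI) PI) t
    (RInt (fun x => (u x t + u x t ^ 2 / 2) * e1 x) (- PI) PI).
Proof.
  intros Ju hsol Se De De1 Pe.
  assert (Ce := cts_deriv _ _ De); assert (Ce1 := cts_deriv _ _ De1).
  assert (Cu : forall t, cts (fun x => u x t)) by (intros; now apply jcont_cts_fst).
  assert (J2 : jcont (fun x t => u x t + u x t ^ 2 / 2)).
  { apply (jcont_ext (fun x t => u x t + u x t * u x t * / 2)).
    - intros; field.
    - apply jcont_plus, jcont_mult; [exact Ju | now apply jcont_mult |].
      apply (jcont_fst (fun _ => / 2)), cts_const. }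
  apply (du_bois_reymond (fun t => (1 + q) * RInt (fun x => u x t * e x) (- PI) PI)
    (fun t => RInt (fun x => (u x t + u x t ^ 2 / 2) * e1 x) (- PI) PI)).
  - apply cts_mult; [apply cts_const|]; apply (cts_RInt_param (fun x t => u x t * e x)).
    apply jcont_mult; [exact Ju | now apply jcont_fst].
  - apply (cts_RInt_param (fun x t => (u x t + u x t ^ 2 / 2) * e1 x)).
    apply jcont_mult; [exact J2 | now apply jcont_fst].
  - clear t; intros T chi chi' HT S D Z.
    rewrite <- (hsol T (fun x t => e x * chi t) HT).
    + apply RInt_eq; intros t.
      rewrite (RInt_eq (fun x => u x t * _ + _) (fun x => ((1 + q) * chi' t) * (u x t * e x)
        + chi t * ((u x t + u x t ^ 2 / 2) * e1 x))).
      * rewrite cRInt_plus, !cRInt_scal by auto 12 with cts; eqR; ring.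
      * assert (P01 : forall x, partial_derive 0 1 (fun x t => e x * chi t) x t = e x * chi' t).
        { intros x; apply is_derive_unique, is_derive_Rconst_mult, D. }
        assert (P10 : forall x, partial_derive 1 0 (fun x t => e x * chi t) x t = e1 x * chi t).
        { intros x; apply is_derive_unique, is_derive_Rmult_const, De. }
        assert (P21 : forall x, partial_derive 2 1 (fun x t => e x * chi t) x t
          = - q * e x * chi' t).
        { intros x; unfold partial_derive; simpl Derive_n at 1.
          rewrite (Derive_ext _ (fun x => e1 x * chi' t)).
          - apply is_derive_unique, is_derive_Rmult_const, De1.
          - intros y; rewrite (Derive_ext _ (fun x => e x * chi' t)).
            + apply is_derive_unique, is_derive_Rmult_const, De.
            + intros z; apply P01. }
        intros x; rewrite P01, P10, P21; ring.
    + split; [|split].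
      * intros n x t; apply ex_diff_n_product; [apply Se | apply S].
      * intros t x; cbv beta; now rewrite Pe.
      * intros x t Ht; rewrite (Z t Ht); ring.
Qed.

Lemma uniformly_cts_F (beta c : R) (u : R -> R -> R) :
  (forall t, periodic (fun x => u x t)) -> (forall t, cts (fun x => u x t)) ->
  uniformly_cts u -> uniformly_cts (fun x t => F beta (u x t - c)).
Proof.
  intros Pu Cu Uu t0 eps He.
  destruct (periodic_bounded _ (Pu t0) (Cu t0)) as [M [HM B]].
  (* Bounds the second factor in the factorisation of the difference of [F] below, as long as [u]
     has moved by at most 1. *)
  set (L := Rabs beta + Rabs c + M + 1).
  assert (HL : 1 <= L) by (unfold L; generalize (Rabs_pos beta) (Rabs_pos c); lra).
  set (d := Rmin 1 (eps / L)).
  assert (Hd : 0 < d) by (apply Rmin_pos; [lra | apply Rdiv_lt_0_compat; lra]).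
  generalize (Uu t0 d Hd); apply filter_imp; intros t Ht x; specialize (Ht x); specialize (B x).
  assert (H1 := Rle_trans _ _ _ Ht (Rmin_l _ _)).
  assert (H2 := Rle_trans _ _ _ Ht (Rmin_r _ _)).
  unfold F.
  replace (beta * (u x t - c) + (u x t - c) ^ 2 / 2 - (beta * (u x t0 - c) + (u x t0 - c) ^ 2 / 2))
    with ((u x t - u x t0) * (beta - c + u x t0 + (u x t - u x t0) / 2)) by field.
  rewrite Rabs_mult.
  apply Rle_trans with (eps / L * L); [|right; field; lra].
  apply Rmult_le_compat; auto using Rabs_pos.
  unfold L; clear H2 Ht; unfold Rabs in *;
    repeat (destruct Rcase_abs; [|]); try lra.
Qed.

Lemma uniformly_cts_green' (f : R -> R -> R) : (forall t, cts (fun x => f x t)) ->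
  uniformly_cts f -> uniformly_cts (fun x t => green' (fun y => f y t) x).
Proof.
  intros Cf Uf t0 eps He.
  destruct green'_bound as [K [HK B]].
  assert (Hd : 0 < eps / K) by now apply Rdiv_lt_0_compat.
  generalize (Uf t0 _ Hd); apply filter_imp; intros t Ht x.
  rewrite <- green'_minus by apply Cf.
  replace eps with (K * (eps / K)) by (field; lra).
  apply (B (fun y => f y t - f y t0)); [apply cts_minus; apply Cf | exact Ht].
Qed.

Lemma is_derive_calH (beta y : R) : is_derive (calH beta) y (F beta y).
Proof. unfold calH, F; auto_derive; [trivial | field]. Qed.

Lemma derive_zero_const (f : R -> R) (a b : R) : (forall t, is_derive f t 0) -> f a = f b.
Proof.
  intros D; assert (H := RInt_antideriv f (fun _ => 0) a b D (cts_const 0)).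
  rewrite RInt_cst in H.
  assert (H' : (b - a) * 0 = f b - f a) by exact H; lra.
Qed.

(* The Fourier coefficients of [u(t) - u(0) + int_0^t green' F] have vanishing
   time derivative, so this function is zero by uniqueness of Fourier coefficients. *)
Lemma is_derive_solution (u : R -> R -> R) (c x t : R) :
  in_C_H1 u -> distributional_solution u ->
  is_derive (fun t => u x t) t (- green' (fun y => F (1 + c) (u y t - c)) x).
Proof.
  intros Hu hsol.
  assert (Pu : forall t, periodic (fun x => u x t)) by (intros s; apply (proj1 Hu s)).
  assert (Cu : forall t, cts (fun x => u x t)) by (intros s; exact (proj1 (proj2 (proj1 Hu s)))).
  assert (Uu : uniformly_cts u) by (intros t0 eps He; now apply in_C_H1_uniform).
  assert (Ju : jcont u) by now apply uniformly_cts_jcont.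
  set (f := fun x t => F (1 + c) (u x t - c)).
  assert (Pf : forall t, periodic (fun x => f x t)).
  { intros s y; unfold f; now rewrite (Pu s y). }
  assert (Cf : forall t, cts (fun x => f x t)).
  { intros s; specialize (Cu s); unfold f, F; auto 12 with cts. }
  (* This is [w_x] in its Green representation. *)
  set (v := fun x t => green' (fun y => f y t) x).
  assert (Cv : forall t, cts (fun x => v x t)) by (intros s; apply (cts_green' _ (Pf s) (Cf s))).
  assert (Jv : jcont v).
  { apply uniformly_cts_jcont; [exact Cv|].
    apply uniformly_cts_green'; [exact Cf | now apply uniformly_cts_F]. }
  assert (Cvt : forall y, cts (v y)) by (intros; now apply jcont_cts_snd).
  assert (CI : forall s, cts (fun y => RInt (v y) 0 s)).
  { intros s; apply (cts_RInt_param (fun s y => v y s)); now apply jcont_swap. }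
  assert (Mode : forall (e e1 : R -> R) (q s : R), 0 <= q -> smooth e ->
    (forall x, is_derive e x (e1 x)) -> (forall x, is_derive e1 x (- q * e x)) ->
    periodic e -> periodic e1 ->
    RInt (fun y => (u y s - u y 0 + RInt (v y) 0 s) * e y) (- PI) PI = 0).
  { intros e e1 q s Hq Se De De1 Pe Pe1.
    assert (Ce := cts_deriv _ _ De); assert (Ce1 := cts_deriv _ _ De1).
    assert (Je : jcont (fun y _ => e y)) by now apply jcont_fst.
    assert (D1 : forall r, is_derive (fun r => RInt (fun y => u y r * e y) (- PI) PI) r
      (- RInt (fun y => v y r * e y) (- PI) PI)).
    { intros r.
      (* [is_derive_mode] and [RInt_green_mode] carry the same factor [1 + q], which cancels between
         them. *)
      apply (is_derive_ext (fun r => / (1 + q) * ((1 + q) * RInt (fun y => u y r * e y) (- PI) PI))).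
      - intros r'; eqR; field; lra.
      - eapply is_derive_eq; [apply is_derive_Rconst_mult, is_derive_mode with (e1 := e1); auto|].
        assert (H := proj2 (RInt_green_mode _ (Pf r) (Cf r) e e1 q De De1 Pe Pe1)).
        change (green' (fun x => f x r)) with (fun y => v y r) in H.
        (* The flux differs from [F] by the constant [c + c^2 / 2], whose integral against [e1] is a
           multiple of [e PI - e (- PI) = 0]. *)
        rewrite (RInt_eq (fun y => f y r * e1 y)
          (fun y => (u y r + u y r ^ 2 / 2) * e1 y - (c + c ^ 2 / 2) * e1 y)) in H
          by (intros; unfold f, F; field).
        specialize (Cu r).
        rewrite cRInt_minus, cRInt_scal, (RInt_antideriv e e1) in H by auto 12 with cts.
        replace (e PI) with (e (- PI)) in H
          by (rewrite <- (Pe (- PI)); f_equal; ring).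
        apply Rmult_eq_reg_l with (1 + q); [|lra].
        rewrite <- Rmult_assoc, Rinv_r, Rmult_1_l by lra.
        cbv beta in H; lra. }
    assert (D2 : forall r, is_derive (fun r => RInt (fun y => RInt (v y) 0 r * e y) (- PI) PI) r
      (RInt (fun y => v y r * e y) (- PI) PI)).
    { intros r; apply (is_derive_RInt_parameter (fun y r => RInt (v y) 0 r * e y)
        (fun y r => v y r * e y)).
      - intros y r'; apply is_derive_Rmult_const, is_derive_primitive, Cvt.
      - now apply jcont_mult.
      - intros r'; specialize (CI r'); auto 12 with cts. }
    assert (Split : forall r, RInt (fun y => (u y r - u y 0 + RInt (v y) 0 r) * e y) (- PI) PI
      = RInt (fun y => u y r * e y) (- PI) PI + RInt (fun y => RInt (v y) 0 r * e y) (- PI) PI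
        - RInt (fun y => u y 0 * e y) (- PI) PI).
    { intros r.
      assert (C0 := Cu 0); assert (C1 := Cu r); assert (C2 := CI r).
      rewrite <- cRInt_plus, <- cRInt_minus by auto 12 with cts.
      apply RInt_eq; intros; ring. }
    rewrite (derive_zero_const
      (fun r => RInt (fun y => (u y r - u y 0 + RInt (v y) 0 r) * e y) (- PI) PI) s 0).
    - rewrite (RInt_eq _ (fun _ => 0)).
      + rewrite RInt_cst; eqR; ring.
      + intros y; rewrite (RInt_point (V := R_CompleteNormedModule)); unfold zero; simpl; ring.
    - intros r; apply (is_derive_ext _ _ _ _ (fun r' => eq_sym (Split r'))).
      eapply is_derive_eq; [apply is_derive_Rminus; [apply is_derive_Rplus; [apply D1 | apply D2]|]|].
      + apply (is_derive_const (V := R_NormedModule)).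
      + unfold zero; simpl; ring. }
  assert (Zero : forall s, u x s - u x 0 + RInt (v x) 0 s = 0).
  { intros s; apply (fourier_unique (fun y => u y s - u y 0 + RInt (v y) 0 s)).
    - intros y; rewrite (Pu s y), (Pu 0 y); f_equal.
      apply RInt_eq; intros r; apply (periodic_green' _ (Pf r) (Cf r)).
    - assert (C0 := Cu 0); assert (C1 := Cu s); assert (C2 := CI s); auto 12 with cts.
    - intros k; apply (Mode _ (fun y => - INR k * sin (INR k * y)) (INR k ^ 2)).
      + apply pow2_ge_0.
      + intros n; apply smooth_n_trig.
      + intros y; auto_derive; [trivial | ring].
      + intros y; auto_derive; [trivial | ring].
      + apply (periodic_dilate cos), periodic_cos.
      + intros y; f_equal; apply (periodic_dilate sin), periodic_sin.
    - intros k; apply (Mode _ (fun y => INR k * cos (INR k * y)) (INR k ^ 2)).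
      + apply pow2_ge_0.
      + intros n; apply smooth_n_trig.
      + intros y; auto_derive; [trivial | ring].
      + intros y; auto_derive; [trivial | ring].
      + apply (periodic_dilate sin), periodic_sin.
      + intros y; f_equal; apply (periodic_dilate cos), periodic_cos. }
  apply (is_derive_ext (fun s => u x 0 - RInt (v x) 0 s)).
  - intros s; generalize (Zero s); intros H.
    assert (H' : u x s - u x 0 + RInt (v x) 0 s = 0) by exact H; eqR; lra.
  - eapply is_derive_eq; [apply is_derive_Rminus|].
    + apply (is_derive_const (V := R_NormedModule)).
    + now apply is_derive_primitive.
    + unfold zero, v; simpl; unfold f; ring.
Qed.

(** * The flux identity and the conclusion *)

Lemma RInt_green_flux (f : R -> R) (alpha : R) : periodic f -> cts f ->
  RInt (fun x => exp (alpha * x) * (f x * - green' f x)) (- PI) PI =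
  - (alpha / 2) * RInt (fun x => (exp (alpha * x / 2) * (green' f x + alpha / 2 * green f x)) ^ 2
    + (alpha ^ 2 / 4 - 1) * (exp (alpha * x / 2) * green f x) ^ 2) (- PI) PI
  + sinh (alpha * PI) * (green' f PI ^ 2 + (alpha ^ 2 / 2 - 1) * green f PI ^ 2).
Proof.
  intros Pf Cf.
  assert (Cg := cts_green f Pf Cf); assert (Cg' := cts_green' f Pf Cf).
  assert (Dg := is_derive_green f Pf Cf); assert (Dg' := is_derive_green' f Pf Cf).
  rewrite <- cRInt_scal by auto 14 with cts.
  (* Moving the quadratic integral to the left leaves only the boundary term on the right and makes
     the left integrand the derivative of [P]. *)
  apply Rplus_eq_reg_l with (RInt (fun x => alpha / 2 *
    ((exp (alpha * x / 2) * (green' f x + alpha / 2 * green f x)) ^ 2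
    + (alpha ^ 2 / 4 - 1) * (exp (alpha * x / 2) * green f x) ^ 2)) (- PI) PI).
  rewrite <- Rplus_assoc, <- !cRInt_plus by auto 14 with cts.
  rewrite (RInt_eq (fun x => _ + - (alpha / 2) * _) (fun _ => 0)) by (intros; ring).
  rewrite RInt_cst.
  set (P := fun x => exp (alpha * x) *
    ((green' f x * green' f x - green f x * green f x) * / 2
     + green f x * green f x * (alpha ^ 2 / 4))).
  rewrite (RInt_antideriv P).
  (* By periodicity only the factor [exp (alpha * x)] differs between the endpoints, and its
     increment is [2 * sinh (alpha * PI)]. *)
  - assert (Eg : green f (- PI) = green f PI).
    { rewrite <- (periodic_green f Pf Cf); f_equal; ring. }
    assert (Eg' : green' f (- PI) = green' f PI).
    { rewrite <- (periodic_green' f Pf Cf); f_equal; ring. }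
    unfold P, sinh; rewrite Eg, Eg'.
    replace (alpha * - PI) with (- (alpha * PI)) by ring; eqR; field.
  - intros x; eapply is_derive_eq.
    + apply is_derive_Rmult.
      * auto_derive; [trivial | reflexivity].
      * apply is_derive_Rplus; apply is_derive_Rmult_const;
          [apply is_derive_Rminus|]; apply is_derive_Rmult; auto.
    + rewrite !Rpow_mult_distr.
      replace (exp (alpha * x / 2) ^ 2) with (exp (alpha * x))
        by (simpl; rewrite Rmult_1_r, <- exp_plus; f_equal; field).
      simpl; field.
  - auto 14 with cts.
Qed.

Theorem proposition2p9 (u : R -> R -> R)
  (hu : in_C_H1 u) (hsol : distributional_solution u) (c alpha : R) :
  let beta := 1 + c in
  let z := fun x t : R => u x t - c in
  let w := fun x t : R => inv_one_minus_dxx (fun y => F beta (z y t)) x in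
  let W := fun x t : R => exp (alpha * x / 2) * w x t in
  let N := fun t : R =>
    RInt (fun x => exp (alpha * x) * calH beta (z x t)) (- PI) PI in
  let w_x := fun x t : R => Derive (fun y => w y t) x in
  let W_x := fun x t : R => Derive (fun y => W y t) x in
  is_C1 N /\
  forall t : R,
    Derive N t =
      - (alpha / 2) *
        RInt (fun x => W_x x t ^ 2 + (alpha ^ 2 / 4 - 1) * W x t ^ 2) (- PI) PI
      + sinh (alpha * PI) *
        (w_x PI t ^ 2 + (alpha ^ 2 / 2 - 1) * w PI t ^ 2).
Proof.
  intros beta z w W N w_x W_x.
  assert (Pu : forall t, periodic (fun x => u x t)) by (intros s; apply (proj1 hu s)).
  assert (Cu : forall t, cts (fun x => u x t)) by (intros s; exact (proj1 (proj2 (proj1 hu s)))).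
  assert (Uu : uniformly_cts u) by (intros t0 eps He; now apply in_C_H1_uniform).
  set (f := fun x t => F beta (z x t)).
  assert (Pf : forall t, periodic (fun x => f x t)).
  { intros s y; unfold f, z; now rewrite (Pu s y). }
  assert (Cf : forall t, cts (fun x => f x t)).
  { intros s; specialize (Cu s); unfold f, F, z; auto 12 with cts. }
  assert (Uf : uniformly_cts f) by now apply uniformly_cts_F.
  assert (Jv : jcont (fun x t => green' (fun y => f y t) x)).
  { apply uniformly_cts_jcont; [|now apply uniformly_cts_green'].
    intros s; apply (cts_green' _ (Pf s) (Cf s)). }
  (* From here on [Derive] acts on the explicit Green formula instead of a series. *)
  assert (Ew : forall x t, w x t = green (fun y => f y t) x)
    by (intros; now apply inv_one_minus_dxx_green).
  assert (Ew_x : forall x t, w_x x t = green' (fun y => f y t) x).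
  { intros x t; unfold w_x; rewrite (Derive_ext _ (green (fun y => f y t))) by (intros; apply Ew).
    now apply is_derive_unique, is_derive_green. }
  assert (EW_x : forall x t, W_x x t = exp (alpha * x / 2) *
    (green' (fun y => f y t) x + alpha / 2 * green (fun y => f y t) x)).
  { intros x t; unfold W_x, W.
    rewrite (Derive_ext _ (fun x => exp (alpha * x / 2) * green (fun y => f y t) x))
      by (intros; now rewrite Ew).
    apply is_derive_unique; eapply is_derive_eq.
    - apply is_derive_Rmult; [auto_derive; [trivial | reflexivity] | now apply is_derive_green].
    - unfold Rdiv; ring. }
  set (dN := fun t => RInt (fun x => exp (alpha * x) * (f x t * - green' (fun y => f y t) x))
    (- PI) PI).
  assert (JdN : jcont (fun x t => exp (alpha * x) * (f x t * - green' (fun y => f y t) x))).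
  { apply jcont_mult; [apply (jcont_fst (fun x => exp (alpha * x))); auto 12 with cts|].
    apply jcont_mult; [now apply uniformly_cts_jcont | now apply jcont_opp]. }
  assert (DN : forall t, is_derive N t (dN t)).
  { intros t; apply (is_derive_RInt_parameter (fun x t => exp (alpha * x) * calH beta (z x t))
      (fun x t => exp (alpha * x) * (f x t * - green' (fun y => f y t) x))).
    (* Chain rule with [calH' = F] and the pointwise equation [z_t = - w_x]. *)
    - intros x s; apply is_derive_Rconst_mult.
      assert (D := is_derive_solution u c x s hu hsol).
      eapply is_derive_eq.
      + apply (is_derive_comp (V := R_NormedModule) (calH beta) (fun s => z x s));
          [apply is_derive_calH|].
        apply is_derive_Rminus; [exact D | apply (is_derive_const (V := R_NormedModule))].
      + unfold scal, zero; simpl; unfold mult; simpl; unfold f, z, beta; ring.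
    - exact JdN.
    - intros s; specialize (Cu s); unfold calH, z; auto 12 with cts. }
  assert (EN : forall t, Derive N t = dN t) by (intros; apply is_derive_unique, DN).
  split.
  - intros t; split; [exists (dN t); apply DN|].
    apply (cts_ext dN); [intros; now rewrite EN | now apply cts_RInt_param].
  - intros t; rewrite EN; unfold dN; rewrite RInt_green_flux by easy.
    rewrite Ew, Ew_x; f_equal; f_equal.
    apply RInt_eq; intros x; rewrite EW_x; unfold W; now rewrite Ew.
Qed.
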